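(* Let $\frac12<\delta<1$ and $\rho=2-\frac1\delta$. Let $k=k(d)$ and $N=N(d)$ be integers with $1\le k<d<N$ such that $$\frac dN\to\delta,\qquad \frac kd\to\rho\qquad\text{as } d\to\infty .$$ Let $\Phi$ denote the distribution function of the standard normal distribution. Then the Cover--Efron cones $C_N$ in $\mathbb{R}^d$ satisfy the following. (a) If $\dfrac{N-2d+k}{\sqrt d}\to c$ as $d\to\infty$ with some $c\in\mathbb{R}$ (possibly $c=0$), then $$\lim_{d\to\infty}\frac{\mathbb{E} f_k(C_N)}{\binom Nk}=\Phi\left(-\frac{c}{\sqrt{2(1-\rho)}}\right)\in(0,1).$$ (b) If $N-2d+k\ge c\,d^{\alpha}$ with constants $\frac12<\alpha<1$ and $c>0$, then $$\lim_{d\to\infty}\frac{\mathbb{E} f_k(C_N)}{\binom Nk}=0.$$ (c) If $-c\,d^{\alpha}\le N-2d+k\le c\,d^{\alpha}$ with constants $0<\alpha<\frac12$ and $c\ge0$, then $$\lim_{d\to\infty}\frac{\mathbb{E} f_k(C_N)}{\binom Nk}=\frac12.$$ (d) If $N-2d+k\le c\,d^{\alpha}$ with constants $\frac12<\alpha<1$ and $c<0$, then $$\lim_{d\to\infty}\frac{\mathbb{E} f_k(C_N)}{\binom Nk}=1.$$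
   Context: For each $d$, let $\phi=\phi_d$ be a probability measure on $\mathbb{R}^d$ which is even (i.e. $\phi(A)=\phi(-A)$ for Borel sets $A$) and assigns measure zero to each hyperplane through the origin. For $N\ge d+1$ let $X_1,\dots,X_N$ be independent random vectors with distribution $\phi$, and let $\mathrm{pos}$ denote the positive hull (set of all nonnegative linear combinations). The Cover--Efron cone $C_N$ is the random cone whose distribution is that of $\mathrm{pos}\{X_1,\dots,X_N\}$ conditioned on the event that this positive hull is different from $\mathbb{R}^d$. For a polyhedral convex cone $C\subset\mathbb{R}^d$ and $k\in\{1,\dots,d-1\}$, $f_k(C)$ denotes the number of $k$-dimensional faces of $C$. $\mathbb{E}$ denotes expectation. *)

(* Defs.v *)
From HB Require Import structures.
From mathcomp Require Import all_boot all_order all_algebra finmap.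
From mathcomp Require Import all_classical all_reals all_analysis.

Set Implicit Arguments.
Unset Strict Implicit.
Unset Printing Implicit Defensive.

Import Order.TTheory GRing.Theory Num.Theory.
Import numFieldNormedType.Exports.

Local Open Scope classical_set_scope.
Local Open Scope ring_scope.

(* The library puts a topology, but no sigma-algebra, on row vectors. *)
Definition borel_rV (R : realType) (d : nat) :=
  g_sigma_algebraType (@open 'rV[R]_d).

Definition dotv (R : realType) (d : nat) (u x : 'rV[R]_d) : R :=
  \sum_(i < d) u 0 i * x 0 i.

Definition even_measure (R : realType) (d : nat)
    (mu : probability (borel_rV R d) R) : Prop :=
  forall A : set 'rV[R]_d, measurable (A : set (borel_rV R d)) ->
    mu A = mu [set - x | x in A].

Definition null_on_hyperplanes (R : realType) (d : nat)
    (mu : probability (borel_rV R d) R) : Prop :=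
  forall u : 'rV[R]_d, u != 0 -> mu [set x : 'rV[R]_d | dotv u x = 0] = 0%E.

(* The product rule for subfamilies is the case where some [B i] are [setT]. *)
Definition mutually_independent (disp disp' : measure_display)
    (T : measurableType disp) (T' : measurableType disp') (R : realType)
    (P : probability T R) (n : nat) (X : 'I_n -> {mfun T >-> T'}) : Prop :=
  forall B : 'I_n -> set T', (forall i, measurable (B i)) ->
    P (\bigcap_(i in [set: 'I_n]) (X i @^-1` B i)) =
    (\prod_(i < n) P (X i @^-1` B i))%E.

Definition iid_with_law (disp disp' : measure_display)
    (T : measurableType disp) (T' : measurableType disp') (R : realType)
    (P : probability T R) (mu : probability T' R)
    (n : nat) (X : 'I_n -> {mfun T >-> T'}) : Prop :=
  mutually_independent P X /\
  forall i (A : set T'), measurable A -> distribution P (X i) A = mu A.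

Definition pos_hull (R : realType) (d n : nat) (v : 'I_n -> 'rV[R]_d) :
    set 'rV[R]_d :=
  [set x | exists a : 'I_n -> R,
     (forall i, 0 <= a i) /\ x = \sum_(i < n) a i *: v i].

(* [u = 0] is allowed, so [C] is a face of itself. *)
Definition is_face (R : realType) (d : nat) (C F : set 'rV[R]_d) : Prop :=
  exists u : 'rV[R]_d, (forall x, C x -> dotv u x <= 0) /\
    F = C `&` [set x | dotv u x = 0].

(* [V] is the linear hull of [F]; for a set containing 0, such as a face of a
   cone, it is also the affine hull. *)
Definition has_dim (R : realType) (d : nat) (F : set 'rV[R]_d) (k : nat) :
    Prop :=
  exists V : {vspace 'rV[R]_d},
    [/\ forall x, F x -> x \in V,
        forall W : {vspace 'rV[R]_d}, (forall x, F x -> x \in W) -> (V <= W)%VS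
      & \dim V = k].

(* Meaningful for polyhedral cones, which have finitely many faces: [fset_set]
   of an infinite set is empty. *)
Definition num_faces (R : realType) (d k : nat) (C : set 'rV[R]_d) : nat :=
  #|` fset_set [set F : set 'rV[R]_d | is_face C F /\ has_dim F k]|.

Definition cond_expectation (disp : measure_display) (T : measurableType disp)
    (R : realType) (P : probability T R) (A : set T) (f : T -> R) : R :=
  (\int[P]_(w in A) f w) / fine (P A).

(* Expected number of k-faces of the Cover-Efron cone, whose law is that of
   the positive hull of the [X i] conditioned on not being the whole space. *)
Definition cover_efron_mean_faces (disp : measure_display)
    (T : measurableType disp) (R : realType) (P : probability T R)
    (d n : nat) (X : 'I_n -> {mfun T >-> borel_rV R d}) (k : nat) : R :=
  let pos_X (w : T) : set 'rV[R]_d := pos_hull (fun i => X i w) in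
  cond_expectation P [set w | pos_X w <> setT]
    (fun w => (num_faces k (pos_X w))%:R).

Definition std_normal_cdf (R : realType) (x : R) : R :=
  fine (normal_prob (0 : R) 1 `]-oo, x]).

(* Main.v *)
(* Let [b p q] ([binom_tail]) be the probability of fewer than [q] heads in [p]
   fair coin tosses. Call a pair of disjoint index sets [S], [T] separated ([sep])
   if some hyperplane contains the [X_i], [i] in [S], and has the [X_i], [i] in
   [T], strictly on one side. In general position, for a further index [j],
   [S, T] is separated iff [S, T + j] is separated for [X] or for [X] with [X_j]
   replaced by [- X_j], and [S + j, T] is separated iff both hold. As [phi] is
   even, the probabilities [P (S, T)] of separation therefore satisfy
   [2 P (S, T + j) = P (S, T) + P (S + j, T)], which is Pascal's rule, so
   [P (S, T) = b (#|T| - 1) (d - #|S|)]. General position holds almost surely,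
   and there the cone is not the whole space iff [set0, setT] is separated, while
   its [k]-faces correspond to the [k]-sets [S] with [S, ~: S] separated. Hence
   [E f_k / 'C(N, k) = b (N - k - 1) (d - k) / b (N - 1) d].

   The denominator tends to 1 by Chebyshev's inequality, which also gives the
   limit of the numerator in (b) and (d); (a) and (c) follow from the central
   limit theorem for symmetric binomial laws. For the latter no asymptotics of
   the central binomial coefficient are needed: on a window of [K] standard
   deviations the ratio of the weight of a point to the normal mass of the cell
   at that point is constant up to a factor [1 + o(1)], and both laws have little
   mass outside of the window. *)

Require Import Defs.
From HB Require Import structures.
From mathcomp Require Import all_boot all_order all_algebra.
From mathcomp Require Import all_classical all_reals all_analysis.
From mathcomp Require Import measurable_realfun finmap ring lra zify.

Import Order.TTheory GRing.Theory Num.Theory.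
Import numFieldNormedType.Exports.

Set Implicit Arguments.
Unset Strict Implicit.
Unset Printing Implicit Defensive.

Local Open Scope classical_set_scope.
Local Open Scope ring_scope.

(** * Separating hyperplanes and general position *)

Lemma dotvDl (R : realType) d (u w x : 'rV[R]_d) :
  dotv (u + w) x = dotv u x + dotv w x.
Proof. by rewrite -big_split; apply: eq_bigr => i _; rewrite mxE mulrDl. Qed.

Lemma dotvZl (R : realType) d a (u x : 'rV[R]_d) :
  dotv (a *: u) x = a * dotv u x.
Proof. by rewrite mulr_sumr; apply: eq_bigr => i _; rewrite mxE mulrA. Qed.

Lemma dotvC (R : realType) d (u x : 'rV[R]_d) : dotv u x = dotv x u.
Proof. by apply: eq_bigr => i _; rewrite mulrC. Qed.

Lemma dotvDr (R : realType) d (u x y : 'rV[R]_d) :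
  dotv u (x + y) = dotv u x + dotv u y.
Proof. by rewrite dotvC dotvDl !(dotvC u). Qed.

Lemma dotvZr (R : realType) d a (u x : 'rV[R]_d) :
  dotv u (a *: x) = a * dotv u x.
Proof. by rewrite dotvC dotvZl dotvC. Qed.

Lemma dotvNr (R : realType) d (u x : 'rV[R]_d) : dotv u (- x) = - dotv u x.
Proof. by rewrite -scaleN1r dotvZr mulN1r. Qed.

Lemma dotvNl (R : realType) d (u x : 'rV[R]_d) : dotv (- u) x = - dotv u x.
Proof. by rewrite -scaleN1r dotvZl mulN1r. Qed.

Lemma dotv0 (R : realType) d (u : 'rV[R]_d) : dotv u 0 = 0.
Proof. by apply: big1 => i _; rewrite mxE mulr0. Qed.

Lemma dot0v (R : realType) d (u : 'rV[R]_d) : dotv 0 u = 0.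
Proof. by rewrite dotvC dotv0. Qed.

Lemma dotv_delta (R : realType) d (u : 'rV[R]_d) l :
  dotv u (delta_mx 0 l) = u 0 l.
Proof.
rewrite /dotv (bigD1 l)//= mxE !eqxx mulr1 big1 ?addr0// => j /negbTE jl.
by rewrite mxE eqxx jl mulr0.
Qed.

Lemma dotv_sumr (R : realType) d (u : 'rV[R]_d) (I : Type) (r : seq I)
    (p : pred I) (F : I -> 'rV[R]_d) :
  dotv u (\sum_(i <- r | p i) F i) = \sum_(i <- r | p i) dotv u (F i).
Proof.
by apply: (big_morph (dotv u)); [exact: dotvDr | exact: dotv0].
Qed.

Lemma dotv_comb (R : realType) d n (u : 'rV[R]_d) (a : 'I_n -> R) v :
  dotv u (\sum_(i < n) a i *: v i) = \sum_(i < n) a i * dotv u (v i).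
Proof. by rewrite dotv_sumr; apply: eq_bigr => i _; rewrite dotvZr. Qed.

Lemma dotv_gt0 (R : realType) d (u : 'rV[R]_d) : u != 0 -> 0 < dotv u u.
Proof.
move=> u0; rewrite lt_def; apply/andP; split; last first.
  by apply: sumr_ge0 => i _; rewrite -expr2 sqr_ge0.
apply: contra u0 => /eqP h; apply/eqP/rowP => i; rewrite mxE; apply/eqP.
move: h; rewrite /dotv => /eqP; rewrite psumr_eq0 => [/allP/(_ i)|j _].
  by rewrite mem_index_enum => /(_ isT)/=; rewrite mulf_eq0 orbb.
by rewrite -expr2 sqr_ge0.
Qed.

(** Farkas' lemma, by induction on the number of generators. A functional that separates [b] from
    the cone of the other generators may be positive at [v ord0]; the induction hypothesis is then
    applied once more, after a projection that kills [v ord0]. *)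
Lemma farkas (R : realType) d n (v : 'I_n -> 'rV[R]_d) (b : 'rV[R]_d) :
  pos_hull v b \/
  exists u, (forall i, dotv u (v i) <= 0) /\ 0 < dotv u b.
Proof.
elim: n v b => [|n IH] v b.
  have [->|b0] := eqVneq b 0.
    by left; exists (fun _ => 0); split => //; rewrite big_ord0.
  by right; exists b; split; [case|exact: dotv_gt0].
have [[a [a0 ->]]|[u [uv ub]]] := IH (fun i => v (lift ord0 i)) b.
  left; exists (fun i => if unlift ord0 i is Some j then a j else 0).
  split; first by move=> i; case: unliftP.
  rewrite big_ord_recl unlift_none scale0r add0r.
  by apply: eq_bigr => i _; rewrite liftK.
have [un|un] := lerP (dotv u (v ord0)) 0.
  right; exists u; split => // i; case: (unliftP ord0 i) => [j ->|->] //.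
(* Project along [v ord0] onto the orthogonal complement of [u]. *)
set q := dotv u (v ord0) in un.
pose pr x := x - (dotv u x / q) *: v ord0.
have [[a [a0 ab]]|[w [wv wb]]] := IH (fun i => pr (v (lift ord0 i))) (pr b).
  (* The coefficient of [v ord0] comes from undoing the projection. It is nonnegative because [u] is
     positive at [b] and nonpositive at the other generators. *)
  left; pose a0' := dotv u b / q - \sum_i a i * (dotv u (v (lift ord0 i)) / q).
  exists (fun i => if unlift ord0 i is Some j then a j else a0'); split.
    move=> i; case: unliftP => [//|_]; rewrite subr_ge0.
    apply: (@le_trans _ _ 0); last by rewrite divr_ge0// ltW.
    apply: sumr_le0 => j _; apply: mulr_ge0_le0 => //.
    by rewrite pmulr_lle0 ?invr_gt0.
  rewrite big_ord_recl unlift_none scalerBl scaler_suml.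
  rewrite -[LHS](subrK ((dotv u b / q) *: v ord0)) -/(pr b).
  rewrite ab addrC -[RHS]addrA; congr (_ + _).
  rewrite -sumrN -big_split; apply: eq_bigr => i _ /=.
  by rewrite liftK /pr scalerBr scalerA addrC.
(* This vector represents the functional [w] composed with the projection, so it vanishes at
   [v ord0]. *)
right; exists (w - (dotv w (v ord0) / q) *: u).
have key x : dotv (w - (dotv w (v ord0) / q) *: u) x = dotv w (pr x).
  by rewrite /pr dotvDl dotvDr dotvNl dotvNr dotvZl dotvZr; ring.
split; last by rewrite key.
move=> i; case: (unliftP ord0 i) => [j ->|->]; first by rewrite key.
by rewrite key /pr divff ?gt_eqF// scale1r subrr dotv0.
Qed.

(** A point missed by the hull yields [u] by Farkas' lemma. Conversely such a [u] itself lies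
    outside of the hull, since [dotv u u > 0]. *)
Lemma pos_hull_neq_setT (R : realType) d n (v : 'I_n -> 'rV[R]_d) :
  pos_hull v <> setT <-> exists u, u != 0 /\ forall i, dotv u (v i) <= 0.
Proof.
split=> [h|[u [u0 uv]] h].
  have [b hb] : exists b, ~ pos_hull v b.
    by apply/existsNP => h'; apply: h; apply/seteqP; split.
  have [//|[u [uv ub]]] := farkas v b.
  exists u; split => //; apply: contraTneq ub => ->; by rewrite dot0v ltxx.
have : pos_hull v u by rewrite h.
move=> [a [a0 e]]; have := dotv_gt0 u0; rewrite {2}e dotv_comb ltNge => /negP; apply.
by apply: sumr_le0 => i _; apply: mulr_ge0_le0.
Qed.

(** Any [d] of the vectors are linearly independent. Determinants make the failure a finite union of
    zero sets of measurable functions. *)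
Definition gen_pos (R : realType) d n (v : 'I_n -> 'rV[R]_d) : Prop :=
  forall f : 'I_d -> 'I_n, injective f -> \det (\matrix_i v (f i)) != 0.

(** List [Z] first, then its complement, and keep the first [d] entries: this extends a small [Z] to
    [d] indices and picks [d] indices from a large one. *)
Lemma pick_inj d n (Z : {set 'I_n}) : (d <= n)%N ->
  exists f : 'I_d -> 'I_n, [/\ injective f,
    (#|Z| <= d)%N -> forall i, i \in Z -> exists j, f j = i &
    (d <= #|Z|)%N -> forall j, f j \in Z].
Proof.
case: n Z => [|n] Z dn.
  case: d dn => // _; exists (fun i => i); split => [//|_ []//|_ []//].
pose s := enum Z ++ enum (~: Z).
have ss : size s = n.+1 by rewrite size_cat -!cardE cardsC card_ord.
have su : uniq s.
  rewrite cat_uniq !enum_uniq /= andbT; apply/hasPn => i /=.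
  by rewrite !mem_enum inE.
exists (fun i : 'I_d => nth ord0 s i); split.
- move=> i j /eqP; rewrite nth_uniq ?ss ?(leq_trans (ltn_ord _))//.
  by move=> /eqP/val_inj.
- move=> Zd i iZ; have hi : (index i (enum Z) < d)%N.
    by rewrite (leq_trans _ Zd)// cardE index_mem mem_enum.
  exists (Ordinal hi); rewrite /= /s nth_cat index_mem mem_enum iZ.
  by rewrite nth_index// mem_enum.
- move=> dZ j; rewrite /s nth_cat -cardE (leq_trans (ltn_ord j) dZ).
  by rewrite -mem_enum mem_nth// -cardE (leq_trans (ltn_ord j) dZ).
Qed.

Lemma mulmx_tr_dotv (R : realType) d (f : 'I_d -> 'rV[R]_d) (u : 'rV[R]_d) i :
  ((\matrix_i f i) *m u^T) i 0 = dotv u (f i).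
Proof.
by rewrite mxE; apply: eq_bigr => j _; rewrite !mxE mulrC.
Qed.

(** The vectors indexed by [Z] are part of a basis, on which a linear functional takes arbitrary
    values. *)
Lemma gen_pos_solve (R : realType) d n (v : 'I_n -> 'rV[R]_d) (Z : {set 'I_n})
    (c : 'I_n -> R) : (d <= n)%N -> gen_pos v -> (#|Z| <= d)%N ->
  exists u, forall i, i \in Z -> dotv u (v i) = c i.
Proof.
move=> dn gv Zd; have [f [fi fZ _]] := pick_inj Z dn.
have um : (\matrix_i v (f i)) \in unitmx by rewrite unitmxE unitfE gv.
exists (invmx (\matrix_i v (f i)) *m \col_i c (f i))^T => i iZ.
have [j <-] := fZ Zd i iZ.
rewrite -(mulmx_tr_dotv (fun j => v (f j))) trmxK mulmxA mulmxV// mul1mx.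
by rewrite mxE.
Qed.

Lemma gen_pos_eq0 (R : realType) d n (v : 'I_n -> 'rV[R]_d) (Z : {set 'I_n})
    (u : 'rV[R]_d) : (d <= n)%N -> gen_pos v -> (d <= #|Z|)%N ->
  (forall i, i \in Z -> dotv u (v i) = 0) -> u = 0.
Proof.
move=> dn gv Zd uZ; have [f [fi _ fZ]] := pick_inj Z dn.
have um : (\matrix_i v (f i)) \in unitmx by rewrite unitmxE unitfE gv.
apply: trmx_inj; rewrite trmx0; apply: (can_inj (mulKmx um)).
rewrite mulmx0; apply/colP => i.
by rewrite (mulmx_tr_dotv (fun j => v (f j))) uZ ?fZ// mxE.
Qed.

Definition sep (R : realType) d n (v : 'I_n -> 'rV[R]_d) (S T : {set 'I_n}) :=
  exists u, (forall i, i \in S -> dotv u (v i) = 0) /\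
            (forall i, i \in T -> dotv u (v i) < 0).

Definition flip (R : realType) d n (j : 'I_n) (v : 'I_n -> 'rV[R]_d) i :=
  if i == j then - v i else v i.

Lemma flip_notin (R : realType) d n (v : 'I_n -> 'rV[R]_d) (S T : {set 'I_n})
    j i : j \notin S -> j \notin T -> i \in S \/ i \in T -> flip j v i = v i.
Proof.
move=> jS jT; rewrite /flip; case: eqVneq => // -> [].
  by rewrite (negbTE jS).
by rewrite (negbTE jT).
Qed.

(** Finiteness of [T] gives a common [e]; the absolute value lets it serve for perturbations of
    either sign. *)
Lemma small_perturb (R : realType) (I : finType) (T : {set I}) (a b : I -> R) :
  (forall i, i \in T -> a i < 0) ->
  exists2 e, 0 < e & forall i, i \in T -> a i + e * `|b i| < 0.
Proof.
move=> aT; suff [e e0 h] : exists2 e, 0 < e &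
    forall i, i \in enum T -> a i + e * `|b i| < 0.
  by exists e => // i iT; apply: h; rewrite mem_enum.
have : forall i, i \in enum T -> a i < 0 by move=> i; rewrite mem_enum; exact: aT.
elim: (enum T) => [|x s IH] ha; first by exists 1.
have [|e e0 he] := IH; first by move=> i si; apply: ha; rewrite inE si orbT.
have ax := ha x (mem_head _ _).
exists (Num.min e (- a x / (1 + `|b x|))).
  by rewrite lt_min e0 divr_gt0 ?oppr_gt0// ltr_wpDr.
move=> i; rewrite inE => /predU1P[->|si].
  have b1 : 0 < 1 + `|b x| by rewrite ltr_wpDr.
  have : Num.min e (- a x / (1 + `|b x|)) * (1 + `|b x|) <= - a x.
    by rewrite -ler_pdivlMr// ge_min lexx orbT.
  have : 0 < Num.min e (- a x / (1 + `|b x|)).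
    by rewrite lt_min e0 divr_gt0 ?oppr_gt0// ltr_wpDr.
  lra.
apply: le_lt_trans (he i si); rewrite lerD2l ler_wpM2r//.
by rewrite ge_min lexx.
Qed.

(** As [j |: S] has at most [d] elements, some functional vanishes on [S] and equals 1 or -1 at
    [v j]. Adding a small multiple of it tilts the hyperplane to the chosen side of [v j] and keeps
    [T] strictly on its side. *)
Lemma sep_perturb (R : realType) d n (v : 'I_n -> 'rV[R]_d) (S T : {set 'I_n})
    (j : 'I_n) u : (d <= n)%N -> gen_pos v -> (#|S| < d)%N -> j \notin S ->
  (forall i, i \in S -> dotv u (v i) = 0) ->
  (forall i, i \in T -> dotv u (v i) < 0) ->
  forall b : bool, exists w, [/\ forall i, i \in S -> dotv w (v i) = 0,
     forall i, i \in T -> dotv w (v i) < 0 &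
     exists2 e, 0 < e & dotv w (v j) = dotv u (v j) + (-1) ^+ b * e].
Proof.
move=> dn gv Sd jS uS uT b.
have [w hw] := @gen_pos_solve _ _ _ v (j |: S)
  (fun i => if i == j then (-1) ^+ b else 0) dn gv ltac:(by rewrite cardsU1 jS).
have [e e0 he] := @small_perturb _ _ T (fun i => dotv u (v i))
  (fun i => dotv w (v i)) uT.
exists (u + e *: w); split.
- move=> i iS; rewrite dotvDl dotvZl uS// hw ?inE ?iS ?orbT// ifF ?mulr0 ?addr0//.
  by apply: contraNF jS => /eqP <-.
- move=> i iT; rewrite dotvDl dotvZl; apply: le_lt_trans (he i iT).
  by rewrite lerD2l ler_wpM2l ?ler_norm// ltW.
- by exists e => //; rewrite dotvDl dotvZl hw ?inE ?eqxx// mulrC.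
Qed.

Lemma sep_flip_notin (R : realType) d n (v : 'I_n -> 'rV[R]_d)
    (S T : {set 'I_n}) (j : 'I_n) : j \notin S -> j \notin T ->
  sep (flip j v) S T <-> sep v S T.
Proof.
move=> jS jT; have fE i : i \in S \/ i \in T -> flip j v i = v i by exact: flip_notin.
split=> -[u [uS uT]]; exists u; split=> i h.
- by rewrite -fE ?uS//; left.
- by rewrite -fE ?uT//; right.
- by rewrite fE ?uS//; left.
- by rewrite fE ?uT//; right.
Qed.

(** After a tilt the hyperplane misses [v j], and the side on which [v j] lies decides between [v]
    and [flip j v]. *)
Lemma sep_or (R : realType) d n (v : 'I_n -> 'rV[R]_d) (S T : {set 'I_n})
    (j : 'I_n) : (d <= n)%N -> gen_pos v -> (#|S| < d)%N ->
  j \notin S -> j \notin T ->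
  sep v S T <-> sep v S (j |: T) \/ sep (flip j v) S (j |: T).
Proof.
move=> dn gv Sd jS jT; split; last first.
  move=> [|] h; [|apply/(sep_flip_notin v jS jT)].
    case: h => u [uS uT]; exists u; split=> // i iT.
    by apply: uT; rewrite inE iT orbT.
  case: h => u [uS uT]; exists u; split=> // i iT.
  by apply: uT; rewrite inE iT orbT.
move=> [u [uS uT]].
have [w [wS wT wj]] : exists w, [/\ forall i, i \in S -> dotv w (v i) = 0,
    forall i, i \in T -> dotv w (v i) < 0 & dotv w (v j) != 0].
  have [uj|uj] := eqVneq (dotv u (v j)) 0; last by exists u.
  have [w [wS wT [e e0 we]]] := sep_perturb dn gv Sd jS uS uT false.
  by exists w; split => //; rewrite we uj add0r mul1r gt_eqF.
have fE i : i \in S \/ i \in T -> flip j v i = v i by exact: flip_notin.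
move: wj; rewrite neq_lt => /orP[wj|wj]; [left|right]; exists w; split=> //.
- by move=> i; rewrite !inE => /predU1P[->//|]; exact: wT.
- by move=> i iS; rewrite fE; [exact: wS|left].
- move=> i; rewrite !inE => /predU1P[->|iT].
    by rewrite /flip eqxx dotvNr oppr_lt0.
  by rewrite fE; [exact: wT|right].
Qed.

(** A hyperplane through [v j] can be tilted to both sides. Conversely, two normals with opposite
    signs at [v j] have a positive combination that vanishes there. *)
Lemma sep_and (R : realType) d n (v : 'I_n -> 'rV[R]_d) (S T : {set 'I_n})
    (j : 'I_n) : (d <= n)%N -> gen_pos v -> (#|S| < d)%N ->
  j \notin S -> j \notin T ->
  sep v (j |: S) T <-> sep v S (j |: T) /\ sep (flip j v) S (j |: T).
Proof.
move=> dn gv Sd jS jT.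
have fE i : i \in S \/ i \in T -> flip j v i = v i by exact: flip_notin.
split=> [[u [uS uT]]|[[u1 [u1S u1T]] [u2 [u2S u2T]]]].
  have uj : dotv u (v j) = 0 by apply: uS; rewrite !inE eqxx.
  have uS' i : i \in S -> dotv u (v i) = 0.
    by move=> iS; apply: uS; rewrite inE iS orbT.
  split.
    have [w [wS wT [e e0 we]]] := sep_perturb dn gv Sd jS uS' uT true.
    exists w; split => // i; rewrite !inE => /predU1P[->|]; last exact: wT.
    by rewrite we uj add0r mulN1r oppr_lt0.
  have [w [wS wT [e e0 we]]] := sep_perturb dn gv Sd jS uS' uT false.
  exists w; split => [i iS|i]; first by rewrite fE; [exact: wS|left].
  rewrite !inE => /predU1P[->|iT]; last by rewrite fE; [exact: wT|right].
  by rewrite /flip eqxx dotvNr we uj add0r mul1r oppr_lt0.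
have a0 : dotv u1 (v j) < 0 by apply: u1T; rewrite !inE eqxx.
have b0 : 0 < dotv u2 (v j).
  by have := u2T j; rewrite /flip eqxx dotvNr oppr_lt0; apply; rewrite !inE eqxx.
(* Both coefficients, [dotv u2 (v j)] and [- dotv u1 (v j)], are positive, so the combination stays
   negative on [T]. *)
exists (dotv u2 (v j) *: u1 - dotv u1 (v j) *: u2).
have E i : dotv (dotv u2 (v j) *: u1 - dotv u1 (v j) *: u2) (v i) =
  dotv u2 (v j) * dotv u1 (v i) - dotv u1 (v j) * dotv u2 (v i).
  by rewrite dotvDl dotvNl !dotvZl.
split=> i.
  rewrite !inE => /predU1P[->|iS]; first by rewrite E mulrC subrr.
  by rewrite E u1S// -(fE i) ?u2S ?mulr0 ?subr0//; left.
move=> iT; rewrite E.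
have h1 : dotv u1 (v i) < 0 by apply: u1T; rewrite inE iT orbT.
have h2 : dotv u2 (v i) < 0.
  by rewrite -(fE i); [apply: u2T; rewrite inE iT orbT|right].
nra.
Qed.

(** * Faces of a cone spanned by vectors in general position *)

(** The candidate faces. The coefficients run over all generators and vanish off [S], so that they
    compare directly with those in [pos_hull]. *)
Definition pos_on (R : realType) d n (v : 'I_n -> 'rV[R]_d) (S : {set 'I_n}) :
    set 'rV[R]_d :=
  [set x | exists a : 'I_n -> R, [/\ forall i, 0 <= a i,
     forall i, i \notin S -> a i = 0 & x = \sum_(i < n) a i *: v i]].

Lemma pos_on_gen (R : realType) d n (v : 'I_n -> 'rV[R]_d) (S : {set 'I_n}) i :
  i \in S -> pos_on v S (v i).
Proof.
move=> iS; exists (fun j => (j == i)%:R); split.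
- by move=> j; rewrite ler0n.
- by move=> j jS; case: eqVneq jS => // ->; rewrite iS.
- rewrite (bigD1 i)//= eqxx scale1r big1 ?addr0// => j /negbTE ->.
  by rewrite scale0r.
Qed.

(** A sum of nonpositive terms vanishes only if each term does, so only generators on the hyperplane
    can contribute. *)
Lemma pos_hull_face (R : realType) d n (v : 'I_n -> 'rV[R]_d) u :
  (forall i, dotv u (v i) <= 0) ->
  pos_hull v `&` [set x | dotv u x = 0] =
  pos_on v [set i | dotv u (v i) == 0].
Proof.
move=> uv; apply/seteqP; split=> [x [[a [a0 ->]]]|x [a [a0 aS ->]]] /=.
  rewrite dotv_comb => /eqP.
  rewrite -oppr_eq0 -sumrN psumr_eq0 => [/allP h|i _]; last first.
    by rewrite oppr_ge0 mulr_ge0_le0.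
  exists a; split => // i; rewrite inE => /negbTE ui.
  have := h i; rewrite mem_index_enum => /(_ isT)/=.
  by rewrite oppr_eq0 mulf_eq0 ui orbF => /eqP.
split; first by exists a.
rewrite dotv_comb big1// => i _; have [->|ui] := eqVneq (dotv u (v i)) 0.
  by rewrite mulr0.
by rewrite aS ?mul0r// inE.
Qed.

Lemma pos_hullP (R : realType) d n (v : 'I_n -> 'rV[R]_d) u :
  (forall i, dotv u (v i) <= 0) <-> (forall x, pos_hull v x -> dotv u x <= 0).
Proof.
split=> [uv x [a [a0 ->]]|h i]; last first.
  apply: h; have [a [a0 _ e]] := pos_on_gen v (finset.in_setT i).
  by exists a; split.
rewrite dotv_comb; apply: sumr_le0 => i _; exact: mulr_ge0_le0.
Qed.

(** A functional equal to 1 at one of the vectors and 0 at the others reads off a coefficient, which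
    proves linear independence. *)
Lemma gen_pos_dim (R : realType) d n (v : 'I_n -> 'rV[R]_d) (S : {set 'I_n}) :
  (d <= n)%N -> gen_pos v -> (#|S| <= d)%N ->
  \dim <<[seq v i | i <- enum S]>>%VS = #|S|.
Proof.
move=> dn gv Sd; suff : free (map_tuple v (enum_tuple S)).
  by rewrite /free size_tuple /= => /eqP.
apply/freeP => c; move=> hc i.
have eS (j : 'I_#|S|) : tnth (enum_tuple S) j \in S.
  by rewrite -mem_enum; exact: mem_tnth.
have [u hu] := @gen_pos_solve _ _ _ v S
  (fun j => (j == tnth (enum_tuple S) i)%:R) dn gv Sd.
have {}hc : \sum_(j < #|S|) c j *: v (tnth (enum_tuple S) j) = 0.
  by rewrite -[RHS]hc; apply: eq_bigr => j _; rewrite -tnth_nth tnth_map.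
have := congr1 (dotv u) hc; rewrite dotv0.
rewrite dotv_comb (bigD1 i)//= hu// eqxx mulr1 big1 ?addr0// => j ji.
rewrite hu// (_ : _ == _ = false) ?mulr0//; apply: contraNF ji => /eqP.
have := enum_uniq S; rewrite -[enum S]/(val (enum_tuple S)).
by move/tuple_uniqP => /[apply] ->.
Qed.

(** If [S] had [d] or more elements, [d] of them would already span dimension [d > k]. A smaller [S]
    is linearly independent, and its size is the dimension. *)
Lemma has_dim_pos_on (R : realType) d n (v : 'I_n -> 'rV[R]_d) (S : {set 'I_n})
    k : (d <= n)%N -> gen_pos v -> (k < d)%N ->
  has_dim (pos_on v S) k <-> #|S| = k.
Proof.
move=> dn gv kd; have sub (T : {set 'I_n}) (V : {vspace 'rV[R]_d}) :
    T \subset S -> (forall x, pos_on v S x -> x \in V) ->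
    (<<[seq v i | i <- enum T]>> <= V)%VS.
  move=> TS h; apply/span_subvP => x /mapP[i]; rewrite mem_enum => iT ->.
  by apply: h; apply: pos_on_gen; exact: (fintype.subsetP TS).
have mem x : pos_on v S x -> x \in <<[seq v i | i <- enum S]>>%VS.
  move=> [a [_ aS ->]]; apply: memv_suml => i _.
  have [iS|iS] := boolP (i \in S); last by rewrite aS// scale0r mem0v.
  by apply: memvZ; apply: memv_span; apply: map_f; rewrite mem_enum.
split=> [[V [hV minV kV]]|Sk].
  have [dS|Sd] := leqP d #|S|.
    have [f [fi _ /(_ dS) fS]] := pick_inj S dn.
    have cT : #|[set f j | j : 'I_d]| = d by rewrite card_imset// card_ord.
    have TS : [set f j | j : 'I_d] \subset S.
      by apply/fintype.subsetP => _ /imsetP[j _ ->]; exact: fS.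
    have := dimvS (sub _ _ TS hV).
    by rewrite gen_pos_dim ?cT// kV leqNgt kd.
  have e : V = <<[seq v i | i <- enum S]>>%VS.
    by apply/eqP; rewrite eqEsubv sub// minV.
  by rewrite -kV e gen_pos_dim// ltnW.
exists <<[seq v i | i <- enum S]>>%VS; split => //.
  by move=> W; exact: sub.
by rewrite gen_pos_dim// Sk ltnW.
Qed.

(** The map [S |-> pos_on v S] is a bijection from the [k]-sets separated from their complement to
    the [k]-faces. *)
Lemma num_faces_gen_pos (R : realType) d n (v : 'I_n -> 'rV[R]_d) k :
  (d <= n)%N -> gen_pos v -> (k < d)%N ->
  num_faces k (pos_hull v) =
    #|[set S : {set 'I_n} | (#|S| == k) && `[< sep v S (~: S) >]]%SET|.
Proof.
move=> dn gv kd; set SS := [set S | _]%SET.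
rewrite /num_faces.
have -> : [set F | is_face (pos_hull v) F /\ has_dim F k] =
    [set` [fset pos_on v S | S in SS]%fset].
  apply/seteqP; split=> F.
    move=> [[u [uv ->]]]; have {}uv := (pos_hullP v u).2 uv.
    rewrite pos_hull_face// has_dim_pos_on// => Zk.
    apply/imfsetP; eexists; last reflexivity.
    rewrite /= inE Zk eqxx /=; apply/asboolP; exists u.
    split=> i; rewrite !inE; first by move/eqP.
    by move=> ui; rewrite lt_neqAle ui uv.
  move=> /imfsetP[S /=]; rewrite inE => /andP[/eqP Sk /asboolP[u [uS uT]]] ->.
  have uv i : dotv u (v i) <= 0.
    have [iS|iS] := boolP (i \in S); first by rewrite uS.
    by rewrite ltW// uT// inE.
  split; last by rewrite has_dim_pos_on.
  exists u; split; first exact/pos_hullP.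
  rewrite pos_hull_face//; congr pos_on; apply/setP => i; rewrite inE.
  have [iS|iS] := boolP (i \in S); first by rewrite uS ?eqxx.
  by rewrite lt_eqF// uT// inE.
rewrite set_fsetK card_in_imfset/=.
  by rewrite -cardE.
(* Injectivity: the normal that exposes [pos_on v S] is negative at every generator outside of [S],
   so none of these lies in that face. *)
suff half S S' : S \in SS -> pos_on v S = pos_on v S' -> S' \subset S.
  move=> S S' hS hS' e; apply/eqP; rewrite finset.eqEsubset.
  by rewrite (half S S')// (half S' S).
rewrite inE => /andP[_ /asboolP[u [uS uT]]] e; apply/fintype.subsetP => i iS'.
have : pos_on v S (v i) by rewrite e; exact: pos_on_gen.
move=> [a [a0 aS vi]]; apply: contraT => iS.
have : dotv u (v i) < 0 by apply: uT; rewrite inE.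
rewrite vi dotv_comb big1 ?ltxx// => j _.
have [jS|jS] := boolP (j \in S); first by rewrite uS ?mulr0.
by rewrite aS ?mul0r.
Qed.

(** * Laws of tuples of random vectors *)

Lemma law_exists d d' (T : measurableType d) (T' : measurableType d')
    (R : realType) (P : probability T R) (f : T -> T') :
  measurable_fun setT f ->
  exists m : probability T' R, forall A, m A = P (f @^-1` A).
Proof.
move=> mf; pose g : {mfun T >-> T'} := HB.pack f (isMeasurableFun.Build _ _ _ _ f mf).
by exists (distribution P g).
Qed.

Lemma measurable_entry (R : realType) d (l : 'I_d) :
  measurable_fun setT (fun x : borel_rV R d => (x : 'rV[R]_d) 0 l).
Proof.
apply: (measurability _ (RGenOpens.measurableE R)) => //.
move=> _ [_ [a [b ->]] <-]; rewrite setTI; apply: sub_sigma_algebra.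
apply: (@open_comp _ _ (fun x : 'rV[R]_d => x 0 l)); last exact: interval_open.
by move=> x _; exact: coord_continuous.
Qed.

Lemma measurable_dotv d0 (T : measurableType d0) (R : realType) d
    (u x : T -> 'rV[R]_d) :
  (forall l, measurable_fun setT (fun t => u t 0 l)) ->
  (forall l, measurable_fun setT (fun t => x t 0 l)) ->
  measurable_fun setT (fun t => dotv (u t) (x t)).
Proof.
move=> mu mx; apply: measurable_sum => l.
by apply: measurable_funM.
Qed.

Lemma measurable_opp_rV (R : realType) d :
  measurable_fun setT (fun x : borel_rV R d => - (x : 'rV[R]_d) : borel_rV R d).
Proof.
apply: (@measurability _ _ _ (borel_rV R d) _ _ (@open 'rV[R]_d)) => //.
move=> _ [A oA <-]; rewrite setTI; apply: sub_sigma_algebra.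
by apply: (@open_comp _ _ (fun x : 'rV[R]_d => - x)) => // x _; exact: opp_continuous.
Qed.

Section tuple_laws.
Context (R : realType) (d n : nat).
Local Notation V := (borel_rV R d).
Local Notation W := (n.-tuple V).

Definition vecs (t : W) (i : 'I_n) : 'rV[R]_d := tnth t i.

Definition box (B : 'I_n -> set V) : set W := [set t | forall i, B i (tnth t i)].

Lemma measurable_vecs i l : measurable_fun setT (fun t : W => vecs t i 0 l).
Proof. exact: (measurableT_comp (measurable_entry l) (measurable_tnth i)). Qed.

Lemma boxE (B : 'I_n -> set V) :
  box B = \bigcap_(i in [set: 'I_n]) (@tnth n V ^~ i @^-1` B i).
Proof. by apply/seteqP; split=> [t h i _|t h i]; [exact: (h i)|exact: (h i I)]. Qed.

Lemma measurable_box (B : 'I_n -> set V) :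
  (forall i, measurable (B i)) -> measurable (box B).
Proof.
move=> mB; rewrite boxE; apply: fin_bigcap_measurable => // i _.
by rewrite -[X in measurable X]setTI; exact: measurable_tnth.
Qed.

(** Boxes are stable under intersection and generate the sigma-algebra of the tuples. *)
Lemma box_measure_unique (m1 m2 : {measure set W -> \bar R}) :
  (m1 setT < +oo)%E ->
  (forall B, (forall i, measurable (B i)) -> m1 (box B) = m2 (box B)) ->
  forall A, measurable A -> m1 A = m2 A.
Proof.
move=> m1oo m12 A mA.
pose G : set (set W) := [set C | exists2 B, forall i, measurable (B i) & C = box B].
have GT : G setT.
  by exists (fun _ => setT) => //; apply/seteqP; split.
apply: (measure_unique G (fun _ => setT)) => //.
(* The coordinate preimages, which generate by definition, are the boxes with a single nontrivial
   side. *)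
- rewrite [LHS]/(g_sigma_preimage _); apply/seteqP; split.
    apply: smallest_sub; first exact: smallest_sigma_algebra.
    move=> C hC; apply: sub_sigma_algebra; move: hC.
    rewrite -bigcup_seq => -[i _ [B mB <-]].
    exists (fun k => if k == i then B else setT).
      by move=> k; case: ifP.
    apply/seteqP; split=> t /=.
      by move=> [_ Bt] k; case: eqVneq => // ->.
    by move=> /(_ i); rewrite eqxx.
  apply: smallest_sub; first exact: smallest_sigma_algebra.
  by move=> _ [B mB ->]; exact: measurable_box.
- move=> _ _ [B mB ->] [B' mB' ->]; exists (fun i => B i `&` B' i).
    by move=> i; exact: measurableI.
  apply/seteqP; split=> t; first by move=> [h h'] i; split; [exact: h|exact: h'].
  by move=> h; split=> i; have [] := h i.
- by rewrite bigcup_const//; exists 0%N.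
- by move=> _ [B mB ->]; exact: m12.
Qed.

Definition flip_tuple (j : 'I_n) (t : W) : W := [tuple flip j (vecs t) i | i < n].

Lemma vecs_flip j t : vecs (flip_tuple j t) = flip j (vecs t).
Proof. by apply/funext => i; rewrite /vecs tnth_mktuple. Qed.

Lemma measurable_flip_tuple j : measurable_fun setT (flip_tuple j).
Proof.
apply/measurable_fun_tnthP => i.
rewrite (_ : _ \o _ = fun t => flip j (vecs t) i); last first.
  by apply/funext => t /=; rewrite tnth_mktuple.
rewrite /flip; case: eqVneq => _; last exact: measurable_tnth.
exact: (measurableT_comp (@measurable_opp_rV R d) (measurable_tnth i)).
Qed.

(** Forgets the [j]-th vector but stays within the same type: a function of the other vectors is one
    that is invariant under [zero_tuple j]. *)
Definition zero_tuple (j : 'I_n) (t : W) : W :=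
  [tuple (if i == j then 0 else tnth t i) : V | i < n].

Lemma measurable_zero_tuple j : measurable_fun setT (zero_tuple j).
Proof.
apply/measurable_fun_tnthP => i.
rewrite (_ : _ \o _ = fun t : W => (if i == j then 0 else tnth t i) : V); last first.
  by apply/funext => t /=; rewrite tnth_mktuple.
by case: eqVneq => _; [exact: measurable_cst|exact: measurable_tnth].
Qed.

Definition product_law (phi : probability V R) (m : probability W R) :=
  forall B, (forall i, measurable (B i)) -> m (box B) = (\prod_(i < n) phi (B i))%E.

(** On a box the flip replaces one factor [phi (B j)] by the measure of the reflected set, which is
    the same as [phi] is even; boxes determine the law. *)
Lemma flip_law (phi : probability V R) (m : probability W R) j A :
  even_measure phi -> product_law phi m -> measurable A ->
  m (flip_tuple j @^-1` A) = m A.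
Proof.
move=> ephi hm mA; have [m' hm'] := law_exists m (measurable_flip_tuple j).
rewrite -hm'; apply: box_measure_unique => //.
  by rewrite (le_lt_trans (probability_le1 _ _)) ?ltry.
move=> B mB; apply: etrans (hm' _) _; apply/esym; apply: etrans (hm _ mB) _.
pose nB i : set V := if i == j then [set - (x : 'rV[R]_d) | x in B i] else B i.
have nBE i : i = j -> nB i = (fun x : V => - (x : 'rV[R]_d) : V) @^-1` B i.
  rewrite /nB => ->; rewrite eqxx; apply/seteqP; split=> x /=.
    by move=> [y By <-]; rewrite opprK.
  by move=> Bx; exists (- (x : 'rV[R]_d)) => //; rewrite opprK.
have mnB i : measurable (nB i).
  have [ij|ij] := eqVneq i j; last by rewrite /nB (negbTE ij).
  rewrite nBE// -[X in measurable X]setTI; exact: measurable_opp_rV.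
rewrite (_ : _ @^-1` _ = box nB).
  rewrite hm//; apply: eq_bigr => i _; rewrite /nB; case: eqVneq => // ->.
  exact: ephi.
apply/seteqP; split=> t h i; have := h i.
  rewrite /= tnth_mktuple /flip; have [->|ij] := eqVneq i j; first by rewrite nBE.
  by rewrite /nB (negbTE ij).
rewrite /= tnth_mktuple /flip; have [->|ij] := eqVneq i j; first by rewrite nBE.
by rewrite /nB (negbTE ij).
Qed.
End tuple_laws.

(** Counterpart of [law_exists] for measures of arbitrary mass, such as the restriction of a law to
    an event. *)
Lemma measure_image_exists d d' (T : measurableType d) (T' : measurableType d')
    (R : realType) (P : {measure set T -> \bar R}) (f : T -> T') :
  measurable_fun setT f ->
  exists m : {measure set T' -> \bar R}, forall A, m A = P (f @^-1` A).
Proof.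
move=> mf; unshelve eexists (pushforward P f : {measure set T' -> \bar R}) => //.
Qed.

Lemma measurable_neq0_orthogonal d0 (T : measurableType d0) (R : realType) d
    (u x : T -> 'rV[R]_d) :
  (forall l, measurable_fun setT (fun t => u t 0 l)) ->
  (forall l, measurable_fun setT (fun t => x t 0 l)) ->
  measurable [set t | u t != 0 /\ dotv (u t) (x t) = 0].
Proof.
move=> mu mx.
have -> : [set t | u t != 0 /\ dotv (u t) (x t) = 0] =
    (\bigcup_(l in [set: 'I_d]) ~` [set t | u t 0 l = 0]) `&`
    [set t | dotv (u t) (x t) = 0].
  apply/seteqP; split=> z [h1 h2]; split => //.
    apply: contrapT => h3; move/eqP: h1; apply; apply/rowP => l.
    by rewrite mxE; apply: contrapT => h4; apply: h3; exists l.
  by case: h1 => l _ /= h3; apply/eqP => h4; apply: h3; rewrite h4 mxE.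
apply: measurableI.
  apply: fin_bigcup_measurable => // l _; apply: measurableC.
  rewrite -[X in measurable X]setTI.
  exact: (mu l measurableT _ (measurable_set1 0)).
rewrite -[X in measurable X]setTI.
exact: (measurable_dotv mu mx measurableT (measurable_set1 0)).
Qed.

(** * Degenerate configurations have probability zero *)

Section general_position.
Context (R : realType) (d n : nat).
Local Notation V := (borel_rV R d).
Local Notation W := (n.-tuple V).
Context (phi : probability V R) (m : probability W R).
Hypotheses (phi0 : null_on_hyperplanes phi) (hm : product_law phi m).

(** The [j]-th vector is independent of the others. For fixed [B] both sides are finite measures in
    [A], so it suffices to take boxes. *)
Lemma zero_tuple_indep j (A : set W) (B : set V) :
  measurable A -> measurable B ->
  m (zero_tuple j @^-1` A `&` (@tnth n V ^~ j) @^-1` B) =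
  (m (zero_tuple j @^-1` A) * phi B)%E.
Proof.
move=> mA mB; set C := (@tnth n V ^~ j) @^-1` B.
have mC : measurable C.
  by rewrite -[X in measurable X]setTI; exact: measurable_tnth.
have key D : (forall i, measurable (D i)) ->
    m (zero_tuple j @^-1` box D `&` C) =
    (m (zero_tuple j @^-1` box D) * phi B)%E.
  move=> mD.
  (* After zeroing, the [j]-th side of the box is only tested at 0, so it becomes everything or
     nothing. *)
  pose D' i : set V := if i == j then if `[< D j 0 >] then B else set0 else D i.
  pose D1 i : set V := if i == j then if `[< D j 0 >] then setT else set0 else D i.
  have E1 : zero_tuple j @^-1` box D = box D1.
    apply/seteqP; split=> t h i.
      rewrite /D1; case: eqVneq => [->|ij].
        by have := h j; rewrite tnth_mktuple eqxx => /asboolT ->.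
      by have := h i; rewrite tnth_mktuple (negbTE ij).
    rewrite tnth_mktuple; have := h i; rewrite /D1.
    by case: eqVneq => // ->; case: asboolP.
  have E2 : zero_tuple j @^-1` box D `&` C = box D'.
    rewrite E1; apply/seteqP; split=> [t [h Ct] i|t h].
      by have := h i; rewrite /D1 /D'; case: eqVneq => // ->; case: ifP.
    split=> [i|].
      by have := h i; rewrite /D1 /D'; case: eqVneq => // ->; case: ifP.
    by have := h j; rewrite /D' eqxx; case: ifP.
  rewrite E2 E1 !hm; first last.
  - by move=> i; rewrite /D'; case: ifP => // _; case: ifP.
  - by move=> i; rewrite /D1; case: ifP => // _; case: ifP.
  rewrite (bigD1 j)//= [in RHS](bigD1 j)//= /D' /D1 !eqxx.
  rewrite [in LHS](eq_bigr (fun i => phi (D i))); last first.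
    by move=> i /negbTE ->.
  rewrite [in RHS](eq_bigr (fun i => phi (D i))); last first.
    by move=> i /negbTE ->.
  case: ifP => _; first by rewrite probability_setT mul1e muleC.
  by rewrite !measure0 !mul0e.
have [m1 hm1] := measure_image_exists m (measurable_zero_tuple j).
have [m2 hm2] := measure_image_exists (mrestr m mC) (measurable_zero_tuple j).
have pB : phi B \is a fin_num by exact: fin_num_measure.
have pB0 : 0 <= fine (phi B) by exact: fine_ge0.
suff : m2 A = mscale (NngNum pB0) m1 A.
  by rewrite hm2 /mrestr /mscale/= hm1 fineK// muleC.
apply: (box_measure_unique (m2 := mscale (NngNum pB0) m1)) => //.
  rewrite (_ : m2 setT = m C); last by rewrite hm2; exact: (congr1 m (setTI C)).
  exact: le_lt_trans (probability_le1 _ mC) (ltry _).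
move=> D mD; rewrite hm2; apply: etrans (key D mD) _.
by rewrite -hm1 muleC -[X in (X * _)%E](fineK pB).
Qed.

(** Fubini's theorem: given the other vectors, the normal [u] is fixed, and the [j]-th vector lies
    in its orthogonal hyperplane with probability zero. *)
Lemma hyperplane_null j (u : W -> 'rV[R]_d) :
  (forall l, measurable_fun setT (fun t => u t 0 l)) ->
  (forall t, u (zero_tuple j t) = u t) ->
  m [set t | u t != 0 /\ dotv (u t) (vecs t j) = 0] = 0%E.
Proof.
move=> mu uz; pose h (t : W) : (W * V)%type := (zero_tuple j t, tnth t j).
have mh : measurable_fun setT h.
  by apply: measurable_fun_pair; [exact: measurable_zero_tuple|exact: measurable_tnth].
have [m1 hm1] := law_exists m (measurable_zero_tuple j).
have [m' hm'] := law_exists m mh.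
pose D := [set z : (W * V)%type | u z.1 != 0 /\ dotv (u z.1) z.2 = 0].
have mD : measurable D.
  apply: measurable_neq0_orthogonal => l.
    exact: (measurableT_comp (mu l) measurable_fst).
  exact: (measurableT_comp (measurable_entry l) measurable_snd).
have -> : [set t | u t != 0 /\ dotv (u t) (vecs t j) = 0] = h @^-1` D.
  by apply/seteqP; split=> t; rewrite /D /= uz.
(* By independence, the joint law of the other vectors and the [j]-th one is a product measure. *)
have e : (m1 \x phi)%E D = m' D.
  apply: product_measure_unique mD => A B mA mB; apply: etrans (hm' _) _.
  by apply: etrans (zero_tuple_indep j mA mB) _; rewrite -hm1.
rewrite -hm'; apply: etrans (esym e) _.
rewrite /product_measure1; apply: integral0_eq => t _ /=.
have [ut|ut] := eqVneq (u t) 0.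
  rewrite (_ : xsection D t = set0) ?measure0//.
  by apply/seteqP; split=> x // /set_mem[/=]; rewrite ut eqxx.
rewrite -(phi0 ut); congr (phi _); apply/seteqP; split=> x.
  by move=> /set_mem[].
by move=> hx; exact/mem_set.
Qed.

End general_position.

Lemma measurable_det d0 (T : measurableType d0) (R : realType) r
    (A : T -> 'M[R]_r) :
  (forall i j, measurable_fun setT (fun t => A t i j)) ->
  measurable_fun setT (fun t => \det (A t)).
Proof.
move=> mA; apply: measurable_sum => s; apply: measurable_funM => //.
by apply: measurable_prod => i _; exact: mA.
Qed.

Lemma measure_setU_eq0 d0 (T : measurableType d0) (R : realType)
    (mu : {measure set T -> \bar R}) (A B C : set T) :
  measurable A -> measurable B -> measurable C -> C `<=` A `|` B ->
  mu A = 0%E -> mu B = 0%E -> mu C = 0%E.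
Proof.
move=> mA mB mC CAB A0 B0; have AB0 : mu (A `|` B) = 0%E by exact: null_set_setU.
exact: (subset_measure0 mC (measurableU _ _ mA mB) CAB AB0).
Qed.

Section leading_minors.
Context (R : realType) (d n : nat).
Local Notation V := (borel_rV R d.+1).
Local Notation W := (n.-tuple V).

(** Rows are indexed through a map on all of [nat] and columns through [inord], so that the size [r]
    can grow in an induction. *)
Definition lead_mx (f : nat -> 'I_n) r (t : W) : 'M[R]_r :=
  \matrix_(i < r, j < r) vecs t (f i) 0 (inord j).

(* The last row of [lead_mx f r.+1] enters its determinant only through the
   scalar product with this vector, which depends on the other rows. *)
Definition lead_cofactors (f : nat -> 'I_n) r (t : W) : 'rV[R]_d.+1 :=
  \row_(l < d.+1) if (l < r.+1)%N
                  then cofactor (lead_mx f r.+1 t) ord_max (inord l) else 0.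

Lemma measurable_lead_mx f r :
  measurable_fun setT (fun t : W => \det (lead_mx f r t)).
Proof.
apply: measurable_det => i j.
by under eq_fun do rewrite mxE; exact: measurable_vecs.
Qed.

Lemma measurable_lead_cofactors f r l :
  measurable_fun setT (fun t => lead_cofactors f r t 0 l).
Proof.
have [lr|lr] := boolP (l < r.+1)%N; last first.
  rewrite (_ : (fun _ => _) = cst 0); first exact: measurable_cst.
  by apply/funext => t; rewrite mxE (negbTE lr).
rewrite (_ : (fun _ => _) =
    fun t => cofactor (lead_mx f r.+1 t) ord_max (inord l)); last first.
  by apply/funext => t; rewrite mxE lr.
apply: measurable_funM => //; apply: measurable_det => i j.
by under eq_fun do rewrite !mxE; exact: measurable_vecs.
Qed.

Lemma det_lead_mx f r t : (r < d.+1)%N ->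
  \det (lead_mx f r.+1 t) = dotv (lead_cofactors f r t) (vecs t (f r)).
Proof.
move=> rd; rewrite (expand_det_row _ ord_max).
pose F l := cofactor (lead_mx f r.+1 t) ord_max (inord l) *
            vecs t (f r) 0 (inord l).
rewrite (eq_bigr (fun j : 'I_r.+1 => F j)); last first.
  by move=> j _; rewrite /F inord_val mxE mulrC.
rewrite (big_ord_widen _ F rd) [in LHS]big_mkcond; apply: eq_bigr => l _.
by rewrite mxE /F inord_val; case: ifP => // _; rewrite mul0r.
Qed.

Lemma lead_cofactors_zero f r t :
  (forall i, (i < r)%N -> f i != f r) ->
  lead_cofactors f r (zero_tuple (f r) t) = lead_cofactors f r t.
Proof.
move=> fr; apply/rowP => l; rewrite !mxE; case: ifP => // _.
congr (_ * \det _); apply/matrixP => i j; rewrite !mxE.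
by rewrite /vecs tnth_mktuple lift_max (negbTE (fr _ _)).
Qed.

(** The coordinate at [r] is, up to sign, the preceding leading minor. *)
Lemma lead_cofactors_neq0 f r t : (r < d.+1)%N ->
  \det (lead_mx f r t) != 0 -> lead_cofactors f r t != 0.
Proof.
move=> rd; apply: contra => /eqP/rowP/(_ (inord r)); rewrite !mxE inordK// ltnSn.
have -> : inord r = ord_max :> 'I_r.+1 by apply: val_inj; rewrite /= inordK.
move=> /eqP; rewrite mulf_eq0 signr_eq0 /=; congr (\det _ == 0).
by apply/matrixP => i j; rewrite !mxE !lift_max.
Qed.

Context (phi : probability V R) (m : probability W R).
Hypotheses (phi0 : null_on_hyperplanes phi) (hm : product_law phi m).

Lemma measurable_det_eq0 f r : measurable [set t : W | \det (lead_mx f r t) = 0].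
Proof.
rewrite -[X in measurable X]setTI.
exact: (@measurable_lead_mx f r measurableT _ (measurable_set1 0)).
Qed.

(** Induction on the size: if the preceding minor is nonzero, then vanishing of the next one puts
    the new vector into a hyperplane that depends only on the other vectors. *)
Lemma lead_mx_null (f : nat -> 'I_n) r :
  {in [pred i | (i < d.+1)%N] &, injective f} -> (r <= d.+1)%N ->
  m [set t | \det (lead_mx f r t) = 0] = 0%E.
Proof.
move=> fi; elim: r => [|r IH] rd.
  rewrite (_ : [set _ | _] = set0) ?measure0//; apply/seteqP; split=> t //=.
  by rewrite det_mx00 => /eqP; rewrite oner_eq0.
have fr i : (i < r)%N -> f i != f r.
  move=> ir; apply/eqP => /fi e; have : i = r by apply: e; rewrite inE; lia.
  by move=> ei; rewrite ei ltnn in ir.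
set B := [set t | lead_cofactors f r t != 0 /\
  dotv (lead_cofactors f r t) (vecs t (f r)) = 0].
have mB : measurable B.
  by apply: measurable_neq0_orthogonal => l;
    [exact: measurable_lead_cofactors|exact: measurable_vecs].
apply: (measure_setU_eq0 (measurable_det_eq0 f r) mB) => //.
- exact: measurable_det_eq0.
- move=> t /=; rewrite det_lead_mx// => h.
  have [->|h'] := eqVneq (\det (lead_mx f r t)) 0; [by left|right].
  by split=> //; exact: lead_cofactors_neq0.
- exact: IH (ltnW rd).
- apply: (hyperplane_null phi0 hm).
    exact: measurable_lead_cofactors.
  by move=> t; exact: lead_cofactors_zero.
Qed.
End leading_minors.

(** In this form it is visible that changing the sign of a vector preserves general position. *)
Lemma gen_posP (R : realType) d n (v : 'I_n -> 'rV[R]_d) :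
  gen_pos v <-> forall f : 'I_d -> 'I_n, injective f ->
    forall u, (forall i, dotv u (v (f i)) = 0) -> u = 0.
Proof.
split=> gv f fi.
  move=> u uf; have um : (\matrix_i v (f i)) \in unitmx.
    by rewrite unitmxE unitfE gv.
  apply: trmx_inj; rewrite trmx0; apply: (can_inj (mulKmx um)).
  rewrite mulmx0; apply/colP => i.
  by rewrite (mulmx_tr_dotv (fun j => v (f j))) uf mxE.
apply/negP => /eqP h; have : \det (\matrix_i v (f i))^T == 0.
  by rewrite det_tr h.
move=> /det0P[u u0 hu]; move/eqP: u0; apply; apply: (gv f fi) => i.
rewrite -(mulmx_tr_dotv (fun j => v (f j))).
have := congr1 trmx hu; rewrite trmx_mul trmxK trmx0 => ->.
by rewrite mxE.
Qed.

Lemma gen_pos_flip (R : realType) d n (v : 'I_n -> 'rV[R]_d) j :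
  gen_pos (flip j v) <-> gen_pos v.
Proof.
rewrite !gen_posP; have E u i : dotv u (flip j v i) = 0 <-> dotv u (v i) = 0.
  rewrite /flip; case: eqVneq => // _; rewrite dotvNr.
  by split=> /eqP; rewrite ?oppr_eq0 => /eqP // ->; rewrite oppr0.
by split=> h f fi u uf; apply: (h f fi) => i; apply/E.
Qed.

(** * Rational directions *)

Lemma rat_rV_approx (R : realType) d (u : 'rV[R]_d) e : 0 < e ->
  exists q : 'rV[rat]_d, forall x : 'rV[R]_d,
    `|dotv (map_mx ratr q) x - dotv u x| <= e * \sum_l `|x 0 l|.
Proof.
move=> e0.
have /choice[q hq] : forall l : 'I_d, exists r : rat, `|ratr r - u 0 l| < e.
  move=> l; have := @rat_in_itvoo R (u 0 l - e) (u 0 l + e).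
  case; first by lra.
  move=> r; rewrite in_itv /= => /andP[h1 h2]; exists r.
  by rewrite ltr_norml; lra.
exists (\row_l q l) => x; rewrite /dotv -sumrB mulr_sumr.
apply: le_trans (ler_norm_sum _ _ _) _; apply: ler_sum => l _.
by rewrite !mxE -mulrBl normrM ler_wpM2r// ltW.
Qed.

(** Strict inequalities survive the passage to a nearby rational normal. This makes the event a
    countable union. *)
Lemma sep_rat (R : realType) d n (v : 'I_n -> 'rV[R]_d) (T : {set 'I_n}) :
  sep v finset.set0 T <->
  exists q : 'rV[rat]_d, forall i, i \in T -> dotv (map_mx ratr q) (v i) < 0.
Proof.
split=> [[u [_ uT]]|[q hq]]; last first.
  by exists (map_mx ratr q); split=> // i; rewrite inE.
have [e e0 he] := small_perturb (fun i => \sum_l `|v i 0 l|) uT.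
have [q hq] := rat_rV_approx u e0; exists q => i iT.
have := hq (v i); have := he i iT; rewrite ger0_norm ?sumr_ge0// ler_norml.
by move=> h1 /andP[_ h2]; lra.
Qed.

(* Quantifying over rational directions only makes the event measurable. *)
Lemma pos_hull_setT_rat (R : realType) d n (v : 'I_n -> 'rV[R]_d) :
  pos_hull v = setT <-> exists k : nat, forall (q : 'rV[rat]_d) (l : 'I_d),
    q 0 l = 0 \/
    exists i, `|ratr (q 0 l)| <= k%:R * dotv (map_mx ratr q) (v i).
Proof.
split=> [h|[k hk]]; last first.
  apply: contrapT => /pos_hull_neq_setT[u [u0 uv]].
  have [l ul] : exists l, u 0 l != 0.
    apply: contrapT => h; move/eqP: u0; apply; apply/rowP => l.
    by rewrite mxE; apply: contrapT => /eqP h'; apply: h; exists l.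
  pose S := 1 + \sum_i \sum_l `|v i 0 l|.
  have S0 : 0 < S.
    by rewrite ltr_wpDr// sumr_ge0// => i _; rewrite sumr_ge0.
  have k1 : (0 : R) < 1 + k%:R by rewrite ltr_wpDr.
  (* For [q] within [e] of [u], the coordinate [q 0 l] keeps half of the size of [u 0 l], while
     [k%:R * dotv (map_mx ratr q) (v i)] stays below that half for every [i]. *)
  pose e := `|u 0 l| / (S * (1 + k%:R) * 2).
  have e0 : 0 < e by rewrite divr_gt0 ?normr_gt0// !mulr_gt0.
  have [q hq] := rat_rV_approx u e0.
  have ee : e * S * (1 + k%:R) = `|u 0 l| / 2.
    by rewrite /e; field; rewrite gt_eqF//= gt_eqF.
  have eS : e <= `|u 0 l| / 2.
    have S1 : 1 <= S.
      by rewrite lerDl sumr_ge0// => i _; rewrite sumr_ge0.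
    rewrite -ee -mulrA ler_peMr ?(ltW e0)// -[1]mulr1 ler_pM//.
    by rewrite !mulr1 lerDl.
  have ql : `|u 0 l| / 2 <= `|ratr (q 0 l) : R|.
    have := hq (delta_mx 0 l).
    rewrite [X in e * X](_ : _ = 1); last first.
      rewrite (bigD1 l)//= mxE !eqxx normr1 big1 ?addr0// => j /negbTE jl.
      by rewrite mxE eqxx jl normr0.
    rewrite !dotv_delta mxE mulr1 => h.
    have := ler_normB (ratr (q 0 l)) (ratr (q 0 l) - u 0 l).
    by rewrite opprB addrC subrK; lra.
  have [q0|[i]] := hk q l.
    move: ql; rewrite q0 rmorph0 normr0 leNgt divr_gt0 ?normr_gt0//.
  apply/negP; rewrite -ltNge; apply: lt_le_trans ql.
  have := hq (v i); rewrite ler_norml => /andP[_ h2].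
  have vS : \sum_l `|v i 0 l| <= S - 1.
    rewrite /S addrC addKr (bigD1 i)//= ler_wpDr// sumr_ge0// => j _.
    by rewrite sumr_ge0.
  have := uv i => h3.
  have h4 : dotv (map_mx ratr q) (v i) <= e * (S - 1).
    have : e * \sum_l `|v i 0 l| <= e * (S - 1) by rewrite ler_wpM2l// ltW.
    lra.
  apply: (@le_lt_trans _ _ (k%:R * (e * (S - 1)))); first by rewrite ler_wpM2l.
  have k0 : (0 : R) <= k%:R by [].
  by rewrite -ee; nra.
(* Every signed basis vector is a nonnegative combination of the generators. A number [k] above all
   the coefficient sums serves for every direction [q]. *)
have /choice[a ha] : forall z : 'I_d * bool, exists b : 'I_n -> R,
    (forall i, 0 <= b i) /\ (-1) ^+ z.2 *: delta_mx 0 z.1 = \sum_i b i *: v i.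
  move=> z; have : pos_hull v ((-1) ^+ z.2 *: delta_mx 0 z.1) by rewrite h.
  by move=> [b hb]; exists b.
pose S := \sum_z \sum_i a z i; have [k hk] : exists k : nat, S < k%:R.
  by exists (Num.trunc S).+1; rewrite truncnS_gt.
exists k => q l; have [|ql] := eqVneq (q 0 l) 0; [by left|right].
apply: contrapT => hn.
have {}hn i : k%:R * dotv (map_mx ratr q) (v i) < `|ratr (q 0 l) : R|.
  by rewrite ltNge; apply/negP => h'; apply: hn; exists i.
pose b := (ratr (q 0 l) : R) < 0.
have [a0 av] := ha (l, b).
have := congr1 (dotv (map_mx ratr q)) av.
rewrite dotv_comb dotvZr.
rewrite dotv_delta mxE /= -normrEsign => e.
have aS : \sum_i a (l, b) i <= S.
  rewrite /S (bigD1 (l, b))//= lerDl sumr_ge0// => z _.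
  by rewrite sumr_ge0// => i _; case: (ha z).
have q0 : 0 < `|ratr (q 0 l) : R| by rewrite normr_gt0 fmorph_eq0.
have : k%:R * `|ratr (q 0 l) : R| <= (\sum_i a (l, b) i) * `|ratr (q 0 l)|.
  rewrite {1}e mulr_sumr mulr_suml; apply: ler_sum => i _.
  by rewrite mulrCA ler_wpM2l// ltW.
rewrite ler_pM2r// leNgt => /negP; apply; exact: le_lt_trans hk.
Qed.

(** * Separation probabilities *)

Local Notation fdisj S T := (fintype.disjoint (mem S) (mem T)).

Lemma fdisjU1 (I : finType) (j : I) (S T : {set I}) :
  fdisj (j |: S) T = (j \notin T) && fdisj S T.
Proof. by rewrite !finset.disjoints_subset finset.subUset finset.sub1set inE. Qed.

Lemma measurable_lt_cst d0 (T : measurableType d0) (R : realType) (f : T -> R) c :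
  measurable_fun setT f -> measurable [set t | f t < c].
Proof.
move=> mf; rewrite (_ : [set _ | _] = setT `&` f @^-1` `]-oo, c[).
  exact: mf.
by rewrite setTI; apply/seteqP; split=> t /=; rewrite in_itv.
Qed.

Lemma measurable_ge_cst d0 (T : measurableType d0) (R : realType) (f : T -> R) c :
  measurable_fun setT f -> measurable [set t | c <= f t].
Proof.
move=> mf; rewrite (_ : [set _ | _] = setT `&` f @^-1` `[c, +oo[).
  exact: mf.
by rewrite setTI; apply/seteqP; split=> t /=; rewrite in_itv /= andbT.
Qed.

(** * Measurability of the events *)

Section events.
Context (R : realType) (d n : nat).
Local Notation V := (borel_rV R d).
Local Notation W := (n.-tuple V).

Lemma measurable_dotv_vecs (u : 'rV[R]_d) i :
  measurable_fun setT (fun t : W => dotv u (vecs t i)).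
Proof. by apply: measurable_dotv => l //; exact: measurable_vecs. Qed.

Lemma measurable_pos_hull_neq :
  measurable [set t : W | pos_hull (vecs t) <> setT].
Proof.
pose F (k : nat) (q : 'rV[rat]_d) (l : 'I_d) : set W :=
  if q 0 l == 0 then setT else \bigcup_(i in [set: 'I_n])
    [set t | `|ratr (q 0 l)| <= k%:R * dotv (map_mx ratr q) (vecs t i)].
have mF k q l : measurable (F k q l).
  rewrite /F; case: ifP => // _; apply: fin_bigcup_measurable => // i _.
  apply: measurable_ge_cst; apply: measurable_funM => //.
  exact: measurable_dotv_vecs.
rewrite (_ : [set _ | _] = ~` (\bigcup_k ~` (\bigcup_(q in [set: 'rV[rat]_d])
    ~` \bigcap_(l in [set: 'I_d]) F k q l))); last first.
  apply/seteqP; split=> t /=; apply: contra_not.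
    move=> [k _ /= hk]; apply/pos_hull_setT_rat; exists k => q l.
    have : F k q l t.
      by apply: contrapT => h; apply: hk; exists q => //; apply: contra_not h; exact.
    by rewrite /F; case: eqVneq => [|_ [i _]]; [left|right; exists i].
  move=> /pos_hull_setT_rat[k hk]; exists k => //; move=> [q _]; apply => l _.
  by rewrite /F; have [->|[i hi]] := hk q l; [rewrite eqxx|case: ifP => // _; exists i].
apply: measurableC; apply: bigcupT_measurable => k; apply: measurableC.
apply: countable_bigcupT_measurable; first exact: countableP.
by move=> q; apply: measurableC; apply: fin_bigcap_measurable.
Qed.

Definition gen_pos_set : set W := [set t | gen_pos (vecs t)].

(** Restricted to general position, so that the recursions between these events are equalities of
    sets without an exceptional null set. *)
Definition sep_set (S T : {set 'I_n}) : set W :=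
  gen_pos_set `&` [set t | sep (vecs t) S T].

Definition degenerate_set (f : 'I_d -> 'I_n) : set W :=
  [set t | \det (\matrix_i vecs t (f i)) = 0].

Lemma measurable_degenerate f : measurable (degenerate_set f).
Proof.
have mf : measurable_fun setT (fun t : W => \det (\matrix_i vecs t (f i))).
  apply: measurable_det => i j; under eq_fun do rewrite mxE.
  exact: measurable_vecs.
by rewrite -[X in measurable X]setTI; exact: (mf measurableT _ (measurable_set1 0)).
Qed.

Lemma setC_gen_pos_set : ~` gen_pos_set =
  \big[setU/set0]_(f : {ffun 'I_d -> 'I_n} | injectiveb f) degenerate_set f.
Proof.
rewrite -bigcup_seq_cond; apply/seteqP; split=> t /=.
  move=> h; apply: contrapT => h'; apply: h => f fi; apply/eqP => h''; apply: h'.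
  exists (finfun f); rewrite /= ?mem_index_enum/=.
    by apply/injectiveP => i j; rewrite !ffunE; exact: fi.
  rewrite /degenerate_set /= -h''; congr (\det _).
  by apply/matrixP => i j; rewrite !mxE ffunE.
move=> [f /= /andP[_ /injectiveP fi] h1 h2].
by have /eqP := h2 f fi.
Qed.

Lemma measurable_gen_pos_set : measurable gen_pos_set.
Proof.
rewrite -[gen_pos_set]setCK; apply: measurableC; rewrite setC_gen_pos_set.
by apply: bigsetU_measurable => f _; exact: measurable_degenerate.
Qed.

Lemma sep_set_and (S T : {set 'I_n}) j :
  (d <= n)%N -> (#|S| < d)%N -> j \notin S -> j \notin T ->
  sep_set (j |: S) T =
  sep_set S (j |: T) `&` flip_tuple j @^-1` sep_set S (j |: T).
Proof.
move=> dn Sd jS jT; apply/seteqP; split=> t; rewrite /sep_set /gen_pos_set /=.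
  move=> [gt]; rewrite vecs_flip gen_pos_flip => /(sep_and dn gt Sd jS jT)[h1 h2].
  by split.
rewrite vecs_flip => -[[gt h1] [_ h2]]; split=> //.
exact/(sep_and dn gt Sd jS jT).
Qed.

Lemma sep_set_or (S T : {set 'I_n}) j :
  (d <= n)%N -> (#|S| < d)%N -> j \notin S -> j \notin T ->
  sep_set S T =
  sep_set S (j |: T) `|` flip_tuple j @^-1` sep_set S (j |: T).
Proof.
move=> dn Sd jS jT; apply/seteqP; split=> t; rewrite /sep_set /gen_pos_set /=.
  move=> [gt]; rewrite vecs_flip gen_pos_flip => /(sep_or dn gt Sd jS jT)[h|h].
    by left.
  by right.
rewrite vecs_flip gen_pos_flip => -[[gt h]|[gt h]]; split=> //.
  by apply/(sep_or dn gt Sd jS jT); left.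
by apply/(sep_or dn gt Sd jS jT); right.
Qed.

(** Induction on the size of [S]. The empty set is handled by rational normals; otherwise an element
    of [S] is moved to [T], at the price of intersecting with the flipped event. *)
Lemma measurable_sep_set (S T : {set 'I_n}) :
  (d <= n)%N -> (#|S| <= d)%N -> fdisj S T ->
  measurable (sep_set S T).
Proof.
move=> dn; move Sk : #|S| => k; elim: k S T Sk => [|k IH] S T Sk kd ST.
  move/eqP: Sk; rewrite cards_eq0 => /eqP ->; apply: measurableI.
    exact: measurable_gen_pos_set.
  rewrite (_ : [set _ | _] = \bigcup_(q in [set: 'rV[rat]_d])
      \bigcap_(i in [set` T]) [set t | dotv (map_mx ratr q) (vecs t i) < 0]).
    apply: countable_bigcupT_measurable; first exact: countableP.
    move=> q; apply: fin_bigcap_measurable => // i _; apply: measurable_lt_cst.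
    exact: measurable_dotv_vecs.
  apply/seteqP; split=> t /=; first by move/sep_rat => [q hq]; exists q.
  by move=> [q _ hq]; apply/sep_rat; exists q.
have [j jS] : exists j, j \in S by apply/card_gt0P; rewrite Sk.
have Sj : #|S :\ j| = k by move: Sk; rewrite (cardsD1 j) jS => -[].
have jSj : j \notin S :\ j by rewrite !inE eqxx.
have jT : j \notin T by rewrite (disjointFr ST jS).
have m1 : measurable (sep_set (S :\ j) (j |: T)).
  apply: IH => //; first exact: ltnW.
  rewrite disjoint_sym fdisjU1 jSj disjoint_sym/=.
  by apply: disjointWl ST; exact: subD1set.
rewrite -(finset.setD1K jS) sep_set_and//; last by rewrite Sj.
apply: measurableI => //; rewrite -[X in measurable X]setTI.
exact: (measurable_flip_tuple j measurableT m1).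
Qed.

End events.

Definition binom_tail (R : realType) p q : R := (\sum_(i < q) 'C(p, i))%:R / 2 ^+ p.

Lemma binom_tail0 (R : realType) p : binom_tail R p 0 = 0.
Proof. by rewrite /binom_tail big_ord0 mul0r. Qed.

Lemma binom_tailS (R : realType) p q :
  binom_tail R p.+1 q.+1 = (binom_tail R p q.+1 + binom_tail R p q) / 2.
Proof.
rewrite /binom_tail -mulrDl -mulrA -invfM -exprSr -natrD; congr (_%:R / _).
rewrite big_ord_recl bin0 [in RHS]big_ord_recl bin0 -addnA; congr addn.
by rewrite -big_split; apply: eq_bigr => i _; rewrite binS.
Qed.

Lemma degenerate_null (R : realType) d n (phi : probability (borel_rV R d) R)
    (m : probability (n.-tuple (borel_rV R d)) R) (f : 'I_d -> 'I_n) :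
  null_on_hyperplanes phi -> product_law phi m -> injective f ->
  m (degenerate_set f) = 0%E.
Proof.
case: d phi m f => [|d] phi m f hphi hm fi.
  rewrite (_ : degenerate_set f = set0) ?measure0//; apply/seteqP; split=> t //.
  by rewrite /degenerate_set /= det_mx00 => /eqP; rewrite oner_eq0.
have := @lead_mx_null _ _ _ _ _ hphi hm (fun i => f (inord i)) d.+1 _ (leqnn _).
move=> h; rewrite -[RHS]h.
  congr (m _); apply/seteqP; split=> t; rewrite /degenerate_set /= => <-;
  congr (\det _); by apply/matrixP => i j; rewrite !mxE !inord_val.
move=> i j; rewrite !inE => id jd /fi /(congr1 val) /=.
by rewrite !inordK.
Qed.

Lemma gen_pos_null (R : realType) d n (phi : probability (borel_rV R d) R)
    (m : probability (n.-tuple (borel_rV R d)) R) :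
  null_on_hyperplanes phi -> product_law phi m ->
  m (~` @gen_pos_set R d n) = 0%E.
Proof.
move=> hphi hm; rewrite setC_gen_pos_set.
suff [] : measurable (\big[setU/set0]_(f : {ffun 'I_d -> 'I_n} | injectiveb f)
    @degenerate_set R d n f) /\
  m (\big[setU/set0]_(f : {ffun 'I_d -> 'I_n} | injectiveb f)
    @degenerate_set R d n f) = 0%E by [].
apply: (big_ind (fun A => measurable A /\ m A = 0%E)); first by rewrite measure0.
  move=> A B [mA A0] [mB B0]; split; first exact: measurableU.
  exact: null_set_setU.
move=> f /injectiveP fi; split; first exact: measurable_degenerate.
exact: (degenerate_null hphi hm).
Qed.

(** Induction on the size of [T], from the recursion [rec] and the boundary values [full] and
    [empty]. *)
Lemma sep_set_prob (R : realType) d n (phi : probability (borel_rV R d) R)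
    (m : probability (n.-tuple (borel_rV R d)) R) (S T : {set 'I_n}) :
  even_measure phi -> null_on_hyperplanes phi -> product_law phi m ->
  (d <= n)%N -> (#|S| <= d)%N -> fdisj S T -> (0 < #|T|)%N ->
  fine (m (sep_set S T)) = binom_tail R #|T|.-1 (d - #|S|).
Proof.
move=> ephi hphi hm dn; pose p S T := fine (m (@sep_set R d n S T)).
have mg : fine (m (@gen_pos_set R d n)) = 1.
  have := probability_setC m (@measurable_gen_pos_set R d n).
  rewrite (gen_pos_null hphi hm) => h.
  have fg : m (@gen_pos_set R d n) \is a fin_num.
    by apply: fin_num_measure; exact: measurable_gen_pos_set.
  by move: h; rewrite -(fineK fg) -EFinB => -[] /eqP; rewrite eq_sym subr_eq0 => /eqP.
(* A normal orthogonal to [d] vectors in general position is zero, hence not negative on a nonempty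
   [T']. *)
have full (S' T' : {set 'I_n}) : #|S'| = d -> (0 < #|T'|)%N -> p S' T' = 0.
  move=> Sd /card_gt0P[i iT]; rewrite /p (_ : sep_set _ _ = set0) ?measure0//.
  apply/seteqP; split=> t // -[gt [u [uS uT]]].
  have u0 : u = 0 by apply: (gen_pos_eq0 dn gt _ uS); rewrite Sd.
  by have := uT i iT; rewrite u0 dot0v ltxx.
(* With nothing to separate, the zero normal is admissible. *)
have empty (S' : {set 'I_n}) : p S' finset.set0 = 1.
  rewrite /p -mg; congr (fine (m _)); apply/seteqP; split=> t; first by case.
  by move=> gt; split=> //; exists 0; split=> i; rewrite ?inE ?dot0v.
have rec (S' T' : {set 'I_n}) j : (#|S'| < d)%N -> fdisj S' T' -> j \notin S' ->
    j \notin T' -> p S' (j |: T') = (p S' T' + p (j |: S') T') / 2.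
  move=> Sd ST jS jT.
  have m1 : measurable (@sep_set R d n S' (j |: T')).
    apply: measurable_sep_set => //; first exact: ltnW.
    by rewrite disjoint_sym fdisjU1 jS disjoint_sym.
  have e := flip_law j ephi hm m1.
  have m2 : measurable (flip_tuple j @^-1` @sep_set R d n S' (j |: T')).
    rewrite -[X in measurable X]setTI.
    exact: (measurable_flip_tuple j measurableT m1).
  (* An event and its flipped copy are equally likely, so their union and intersection together have
     twice the probability of the event. *)
  rewrite /p (sep_set_and R dn Sd jS jT) [X in (fine (m X) + _) / _](sep_set_or R dn Sd jS jT).
  have mI := measurableI _ _ m1 m2.
  rewrite measureUfinl//; last first.
    by rewrite (le_lt_trans (probability_le1 _ _)) ?ltry.
  rewrite /= e fineB ?fineD//; try exact: fin_num_measure.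
  by field.
  by rewrite fin_numD !fin_num_measure.
move Tk : #|T| => k; elim: k S T Tk => [//|k IH] S T Tk Sd ST _.
have [j jT] : exists j, j \in T by apply/card_gt0P; rewrite Tk.
have [Sd'|Sd'] := eqVneq #|S| d.
  by rewrite -/(p S T) full ?Tk// Sd' subnn binom_tail0.
have {}Sd : (#|S| < d)%N by rewrite ltn_neqAle Sd' Sd.
have jS : j \notin S by rewrite (disjointFl ST jT).
have jTj : j \notin T :\ j by rewrite !inE eqxx.
have Tj : #|T :\ j| = k by move: Tk; rewrite (cardsD1 j) jT => -[].
have STj : fdisj S (T :\ j) by apply: disjointWr ST; exact: subD1set.
have SjTj : fdisj (j |: S) (T :\ j) by rewrite fdisjU1 jTj.
rewrite -/(p S T) -[T in LHS](finset.setD1K jT) rec//.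
have dS : (d - #|S| = (d - #|j |: S|).+1)%N.
  by rewrite cardsU1 jS add1n subnSK.
(* A single element of [T] is treated apart, since the tail has index [#|T| - 1]: both terms are 1
   and so is the tail of zero tosses. *)
case: k => [|k] in IH Tk Tj *.
  have -> : T :\ j = finset.set0 by apply/eqP; rewrite -cards_eq0 Tj.
  rewrite !empty dS /binom_tail big_ord_recl bin0 big1 ?expr0 ?divr1//.
    by field.
rewrite /p !IH ?Tj ?cardsU1 ?jS ?add1n//.
by rewrite dS cardsU1 jS add1n -binom_tailS.
exact: ltnW.
Qed.

(** * The expected number of faces *)

(** By general position a nonzero normal vanishes on at most [d] generators. Adding a small multiple
    of a functional equal to -1 on these makes all inequalities strict. *)
Lemma gen_pos_hull_neq (R : realType) d n (v : 'I_n -> 'rV[R]_d) :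
  (d <= n)%N -> (0 < n)%N -> gen_pos v ->
  pos_hull v <> setT <-> sep v finset.set0 finset.setT.
Proof.
move=> dn n0 gv; rewrite pos_hull_neq_setT; split=> [[u [u0 uv]]|[u [_ uT]]].
  pose Z := [set i | dotv u (v i) == 0]%SET.
  have Zd : (#|Z| <= d)%N.
    rewrite leqNgt; apply: contra u0 => Zd; apply/eqP.
    by apply: (gen_pos_eq0 dn gv (ltnW Zd)) => i; rewrite inE => /eqP.
  have [w hw] := gen_pos_solve (fun=> -1) dn gv Zd.
  have [i|e e0 he] := @small_perturb _ _ (~: Z) (fun i => dotv u (v i))
    (fun i => dotv w (v i)).
    by rewrite !inE lt_neqAle => ->; rewrite uv.
  exists (u + e *: w); split=> i; first by rewrite inE.
  move=> _; rewrite dotvDl dotvZl; have [iZ|iZ] := boolP (i \in Z).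
    have := iZ; rewrite inE => /eqP ->; rewrite add0r hw// mulrN1.
    by rewrite oppr_lt0.
  apply: le_lt_trans (he i _); last by rewrite inE.
  by rewrite lerD2l ler_wpM2l ?ler_norm// ltW.
exists u; split; last by move=> i; rewrite ltW// uT.
apply: contraTneq (uT (Ordinal n0) (finset.in_setT _)) => ->.
by rewrite dot0v ltxx.
Qed.

Section integral_of_nonmeasurable.
Context d (T : measurableType d) (R : realType) (mu : {measure set T -> \bar R}).
Import HBNNSimple.

(** The integral of a nonnegative function is the supremum over the simple functions below it, which
    is monotone even for nonmeasurable functions. *)
Lemma ge0_le_integralT (f g : T -> \bar R) : (forall x, 0 <= f x)%E ->
  (forall x, f x <= g x)%E -> (\int[mu]_x f x <= \int[mu]_x g x)%E.
Proof.
move=> f0 fg; have g0 x : (0 <= g x)%E by exact: le_trans (fg x).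
rewrite !ge0_integralTE//; apply: ge_ereal_sup => _ [h /= hf <-].
by apply: ereal_sup_ubound; exists h => //= x; exact: le_trans (fg x).
Qed.

(* The number of faces is only known to be measurable off a null set. *)
Lemma ge0_integral_eq_off_null (f g : T -> \bar R) (N : set T) :
  (forall x, 0 <= f x)%E -> (forall x, 0 <= g x)%E -> measurable_fun setT g ->
  measurable N -> mu N = 0%E -> (forall x, ~ N x -> f x = g x) ->
  (\int[mu]_x f x = \int[mu]_x g x)%E.
Proof.
move=> f0 g0 mg mN N0 fg; apply/eqP; rewrite eq_le; apply/andP; split.
  (* A simple function below [f] keeps its integral when cut off on [N], and is then below [g]. *)
  rewrite [leLHS]ge0_integralTE//; apply: ge_ereal_sup => _ [h /= hf <-].
  rewrite -integralT_nnsfun (ge0_negligible_integral mN)//; last 2 first.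
  - exact/measurable_EFinP.
  - by move=> x _; rewrite lee_fin.
  rewrite integral_mkcond; apply: ge0_le_integralT => x; rewrite patchE.
    by case: ifP => //; rewrite lee_fin.
  by case: ifP => // /set_mem[_ Nx]; rewrite -fg.
rewrite (ge0_negligible_integral mN)// integral_mkcond.
apply: ge0_le_integralT => x; rewrite patchE; case: ifP => //.
by move=> /set_mem[_ Nx]; rewrite fg.
Qed.
End integral_of_nonmeasurable.

Section mean_faces.
Context (R : realType) (d n k : nat) (disp : measure_display)
  (T : measurableType disp) (P : probability T R) (phi : probability (borel_rV R d) R)
  (X : 'I_n -> {mfun T >-> borel_rV R d}).
Hypotheses (ephi : even_measure phi) (phi0 : null_on_hyperplanes phi)
  (Xiid : iid_with_law P phi X).

Let Y (w : T) : n.-tuple (borel_rV R d) := [tuple X i w | i < n].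

Let vecsY w : vecs (Y w) = fun i => X i w.
Proof. by apply/funext => i; rewrite /vecs tnth_mktuple. Qed.

Let mY : measurable_fun setT Y.
Proof.
apply/measurable_fun_tnthP => i; rewrite (_ : _ \o _ = X i) //.
by apply/funext => w /=; rewrite tnth_mktuple.
Qed.

Let mYpre A : measurable A -> measurable (Y @^-1` A).
Proof. by move=> mA; rewrite -[X in measurable X]setTI; exact: mY. Qed.

Lemma iid_joint_law : exists m : probability (n.-tuple (borel_rV R d)) R,
  product_law phi m /\ forall A, m A = P (Y @^-1` A).
Proof.
have [m hm] := law_exists P mY; exists m; split => // B mB.
rewrite hm; have [ind same] := Xiid; transitivity (\prod_(i < n) P (X i @^-1` B i))%E.
  rewrite -ind//; congr (P _); apply/seteqP; split=> w h i.
    by move=> _; have := h i; rewrite tnth_mktuple.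
  by rewrite tnth_mktuple; exact: h.
by apply: eq_bigr => i _; exact: same.
Qed.

Lemma prob_pos_hull_neq : (d <= n)%N -> (0 < n)%N ->
  fine (P [set w | pos_hull (fun i => X i w) <> setT]) = binom_tail R n.-1 d.
Proof.
move=> dn n0; have [m [hm hmP]] := iid_joint_law.
have := @sep_set_prob R d n phi m finset.set0 finset.setT ephi phi0 hm dn.
rewrite cards0 cardsT card_ord subn0 => <-//; last by rewrite -setI_eq0 finset.set0I.
have mg := @measurable_gen_pos_set R d n.
have mA := @measurable_pos_hull_neq R d n.
rewrite (_ : [set w | _] = Y @^-1` [set t | pos_hull (vecs t) <> setT]); last first.
  by apply/seteqP; split=> w /=; rewrite vecsY.
rewrite -hmP; congr fine.
set A := [set t | _] in mA *.
have A0 : m (A `\` @gen_pos_set R d n) = 0%E.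
  have sub : A `\` @gen_pos_set R d n `<=` ~` @gen_pos_set R d n by move=> t [].
  apply: (subset_measure0 (measurableD mA mg) (measurableC mg) sub).
  exact: (gen_pos_null phi0 hm).
have -> : m A = m (A `&` @gen_pos_set R d n).
  apply: etrans (measureDI m mA mg) _; apply: etrans _ (add0e _).
  by congr (_ + _)%E.
congr (m _); apply/seteqP; split=> t.
  by move=> [gt h]; split=> //; exact/gen_pos_hull_neq.
by move=> [h gt]; split=> //; exact/gen_pos_hull_neq.
Qed.

(** Almost surely the number of faces is the sum [g] of the indicators of separation over all
    [k]-sets; expectations add up. *)
Lemma integral_num_faces : (d <= n)%N -> (k < d)%N -> (d < n)%N ->
  (\int[P]_(w in [set w | pos_hull (fun i => X i w) <> setT])
    (num_faces k (pos_hull (fun i => X i w)))%:R)%R =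
  'C(n, k)%:R * binom_tail R (n - k).-1 (d - k).
Proof.
move=> dn kd dn'; have [m [hm hmP]] := iid_joint_law.
have mg := @measurable_gen_pos_set R d n.
pose E (S : {set 'I_n}) :=
  if #|S| == k then Y @^-1` @sep_set R d n S (~: S) else set0.
have mE S : measurable (E S).
  rewrite /E; case: eqP => // Sk; apply: mYpre; apply: measurable_sep_set => //.
    by rewrite Sk ltnW.
  by rewrite -setI_eq0 finset.setICr.
pose g w : R := \sum_(S : {set 'I_n}) \1_(E S) w.
rewrite /Rintegral integral_mkcond.
rewrite (@ge0_integral_eq_off_null _ _ _ P _ (fun w => (g w)%:E)
    (Y @^-1` ~` @gen_pos_set R d n)).
- under eq_integral do rewrite -sumEFin.
  rewrite ge0_integral_sum//; last first.
    by move=> S; apply/measurable_EFinP; exact: measurable_indic.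
  rewrite (eq_bigr (fun S : {set 'I_n} => (if #|S| == k then
      binom_tail R (n - k).-1 (d - k) else 0)%:E)); last first.
    move=> S _; rewrite integral_indic// setIT /E.
    case: eqP => Sk; last by rewrite measure0.
    apply: etrans (esym (hmP _)) _; rewrite -[LHS]fineK; last first.
      apply: fin_num_measure; apply: measurable_sep_set => //.
        by rewrite Sk ltnW.
      by rewrite -setI_eq0 finset.setICr.
    have cS : #|~: S| = (n - k)%N by rewrite cardsCs finset.setCK card_ord Sk.
    rewrite (sep_set_prob ephi phi0 hm)// ?Sk ?cS ?subn_gt0//.
    - exact: ltnW.
    - by rewrite -setI_eq0 finset.setICr.
    - exact: ltn_trans kd _.
  rewrite sumEFin /= -big_mkcond sumr_const.
  rewrite (_ : #|_| = 'C(n, k)); first by rewrite mulr_natl.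
  by rewrite -[in RHS](card_ord n) -card_draws; apply: eq_card => S; rewrite inE.
- by move=> w; rewrite patchE; case: ifP.
- by move=> w; rewrite lee_fin sumr_ge0.
- apply/measurable_EFinP; apply: measurable_sum => S.
  exact: measurable_indic.
- by apply: mYpre; exact: measurableC.
- exact: etrans (esym (hmP _)) (gen_pos_null phi0 hm).
move=> w /contrapT; rewrite /gen_pos_set /= vecsY => gw; rewrite patchE.
have EE (S : {set 'I_n}) :
    (w \in E S) = (#|S| == k) && `[< sep (fun i => X i w) S (~: S) >].
  rewrite /E; case: eqP => Sk; last by rewrite in_set0.
  apply/idP/asboolP.
    by move=> /set_mem[_]; rewrite /= vecsY.
  by move=> h; apply/mem_set; split; rewrite /gen_pos_set /= vecsY.
have gE : g w = (num_faces k (pos_hull (fun i => X i w)))%:R.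
  rewrite num_faces_gen_pos// /g -sum1_card natr_sum [RHS]big_mkcond.
  by apply: eq_bigr => S _; rewrite inE indicE EE; case: ifP.
case: ifPn => [_|]; first by rewrite gE.
(* Where the hull is the whole space, [g] vanishes too: a separated [S] would supply a nonzero
   supporting normal. *)
rewrite notin_setE /= => /contrapT h; rewrite /g big1// => S _.
rewrite indicE EE; case: eqP => //= Sk; case: asboolP => // -[u [uS uT]].
have [i iS] : exists i, i \in ~: S.
  by apply/card_gt0P; rewrite cardsCs finset.setCK card_ord Sk subn_gt0 (ltn_trans kd).
have : pos_hull (fun i => X i w) <> setT.
  apply/pos_hull_neq_setT; exists u; split.
    by apply: contraTneq (uT i iS) => ->; rewrite dot0v ltxx.
  move=> l; have [lS|lS] := boolP (l \in S); first by rewrite uS.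
  by rewrite ltW// uT// inE.
by [].
Qed.
End mean_faces.

Lemma binom_tail_gt0 (R : realType) p q : (0 < q)%N -> 0 < binom_tail R p q.
Proof.
case: q => // q _; rewrite divr_gt0 ?exprn_gt0// ltr0n big_ord_recl bin0.
by rewrite addn_gt0.
Qed.

Lemma cover_efron_ratio (R : realType) d n k disp (T : measurableType disp)
    (P : probability T R) (phi : probability (borel_rV R d) R)
    (X : 'I_n -> {mfun T >-> borel_rV R d}) :
  even_measure phi -> null_on_hyperplanes phi -> iid_with_law P phi X ->
  (k < d)%N -> (d < n)%N ->
  cover_efron_mean_faces P X k / 'C(n, k)%:R =
  binom_tail R (n - k).-1 (d - k) / binom_tail R n.-1 d.
Proof.
move=> ephi phi0 Xiid kd dn; rewrite /cover_efron_mean_faces /cond_expectation.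
rewrite (integral_num_faces ephi phi0 Xiid (ltnW dn) kd dn).
rewrite (prob_pos_hull_neq ephi phi0 Xiid (ltnW dn) (leq_ltn_trans _ dn))//.
have kn : (k <= n)%N by rewrite ltnW// (ltn_trans kd).
have C0 : 'C(n, k)%:R != 0 :> R by rewrite pnatr_eq0 -lt0n bin_gt0.
have t0 : binom_tail R n.-1 d != 0.
  by rewrite gt_eqF// binom_tail_gt0// (leq_ltn_trans _ kd).
by field; rewrite C0 t0.
Qed.

(** * The normal distribution function *)

Section normal_cdf.
Context (R : realType).
Local Notation G := (@std_normal_cdf R).
Local Notation g := (@normal_pdf R 0 1).

Lemma std_normal_pdfE (x : R) : g x = normal_peak 1 * expR (- (x ^+ 2 / 2)).
Proof.
rewrite normal_pdfE ?oner_eq0// /normal_fun subr0 expr1n mulr2n mulNr.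
by [].
Qed.

Lemma normal_prob_ocE (a b : R) : a <= b ->
  normal_prob (0 : R) 1 `]a, b] = (G b - G a)%:E.
Proof.
move=> ab; have mI (c d : itv_bound R) : measurable [set` Interval c d] by [].
have fin (c d : itv_bound R) : normal_prob (0 : R) 1 [set` Interval c d] \is a fin_num.
  exact: fin_num_measure.
have : normal_prob (0 : R) 1 `]-oo, b] =
       (normal_prob (0 : R) 1 `]-oo, a] + normal_prob (0 : R) 1 `]a, b])%E.
  rewrite -measureU//; first by rewrite -itv_bndbnd_setU.
  apply/seteqP; split=> x //= []; rewrite !in_itv /= => h1 /andP[h2 _].
  by move: (le_lt_trans h1 h2); rewrite ltxx.
rewrite /std_normal_cdf EFinB !fineK// => ->.
by rewrite [X in (X - _)%E]addeC addeK.
Qed.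

Lemma std_normal_cdf_increment (a b lo hi : R) : a <= b -> 0 <= lo ->
  (forall t, a <= t <= b -> lo <= g t <= hi) ->
  lo * (b - a) <= G b - G a <= hi * (b - a).
Proof.
move=> ab lo0 h.
have e (c : R) : (\int[lebesgue_measure]_(x in `]a, b]) c%:E = (c * (b - a))%:E)%E.
  rewrite integral_cst//= lebesgue_measure_itv/= lte_fin.
  have [ab'|ba] := ltP a b; first by rewrite -EFinB -EFinM.
  by have -> : b = a; [apply/le_anti; rewrite ab ba|rewrite subrr mulr0 mule0].
have mg : measurable_fun `]a, b] (fun x => (g x)%:E).
  by apply/measurable_EFinP; apply: measurable_funTS; exact: measurable_normal_pdf.
rewrite -!lee_fin -normal_prob_ocE// -!e /normal_prob; apply/andP; split.
  apply: ge0_le_integral => //= x; rewrite in_itv/= lee_fin => /andP[ax xb].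
  by have /andP[] := h x ltac:(by rewrite (ltW ax) xb).
have hi0 : 0 <= hi by have /andP[h1 h2] := h a ltac:(by rewrite lexx ab); lra.
apply: ge0_le_integral => //= x; rewrite ?in_itv/= lee_fin.
  by rewrite normal_pdf_ge0.
move=> /andP[ax xb]; by have /andP[] := h x ltac:(by rewrite (ltW ax) xb).
Qed.

Lemma std_normal_cdf_ge0 (x : R) : 0 <= G x.
Proof. exact: fine_ge0. Qed.

Lemma std_normal_cdf_le1 (x : R) : G x <= 1.
Proof.
rewrite /std_normal_cdf -lee_fin fineK; last exact: fin_num_measure.
exact: probability_le1.
Qed.

Lemma std_normal_cdf_mono (a b : R) : a <= b -> G a <= G b.
Proof.
move=> ab; have := normal_prob_ocE ab => h.
by rewrite -subr_ge0 -lee_fin -h; exact: measure_ge0.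
Qed.

Lemma std_normal_cdf_lipschitz (a b : R) : `|G a - G b| <= normal_peak 1 * `|a - b|.
Proof.
wlog ab : a b / a <= b => [hw|].
  by have [/hw//|/ltW/hw] := leP a b; rewrite distrC [in leRHS]distrC.
have /andP[_ h] : 0 * (b - a) <= G b - G a <= normal_peak 1 * (b - a).
  apply: std_normal_cdf_increment => // t _; rewrite normal_pdf_ge0.
  by rewrite normal_pdf_ub// oner_eq0.
rewrite distrC [in leRHS]distrC !ger0_norm ?subr_ge0//.
exact: std_normal_cdf_mono.
Qed.

Lemma std_normal_cdf_strict (a b : R) : a < b -> G a < G b.
Proof.
move=> ab; pose M := `|a| + `|b|.
have /andP[h _] : normal_peak 1 * expR (- (M ^+ 2 / 2)) * (b - a) <= G b - G a
    <= normal_peak 1 * (b - a).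
  apply: std_normal_cdf_increment; first exact: ltW.
    by rewrite mulr_ge0 ?expR_ge0// normal_peak_ge0.
  move=> t /andP[a1 b1]; rewrite normal_pdf_ub ?oner_eq0// andbT.
  rewrite std_normal_pdfE ler_wpM2l ?normal_peak_ge0// ler_expR lerN2.
  rewrite ler_wpM2r// -[leLHS]real_normK ?num_real// ler_sqr ?nnegrE//.
    rewrite /M ler_norml; apply/andP; split.
      by have := ler_norm (- a); have := normr_ge0 b; rewrite normrN; lra.
    by have := ler_norm b; have := normr_ge0 a; lra.
  by rewrite addr_ge0.
rewrite -subr_gt0; apply: lt_le_trans h.
by rewrite !mulr_gt0 ?expR_gt0 ?subr_gt0// normal_peak_gt0// oner_eq0.
Qed.

Lemma std_normal_cdf_gt0_lt1 (x : R) : 0 < G x < 1.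
Proof.
rewrite (le_lt_trans (std_normal_cdf_ge0 (x - 1)))/=; last first.
  by apply: std_normal_cdf_strict; rewrite ltrBlDr ltrDl.
apply: lt_le_trans (std_normal_cdf_le1 (x + 1)).
by apply: std_normal_cdf_strict; rewrite ltrDl.
Qed.

(** Continuity from below along the intervals from [-n] to [n]. *)
Lemma std_normal_cdf_tails (e : R) : 0 < e ->
  exists M : R, forall K, M <= K -> G (- K) <= e /\ 1 - G K <= e.
Proof.
move=> e0; have mI (c d : itv_bound R) : measurable [set` Interval c d] by [].
have : normal_prob (0 : R) 1 `](- n%:R), n%:R]%classic @[n --> \oo] -->
       normal_prob (0 : R) 1 (\bigcup_n `](- n%:R), n%:R]%classic).
  apply: nondecreasing_cvg_mu => //; first exact: bigcupT_measurable.
  move=> n m nm; apply/subsetPset => x /=; rewrite !in_itv /= => /andP[h1 h2].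
  have nm' : (n%:R : R) <= m%:R by rewrite ler_nat.
  by rewrite (le_trans h2)// andbT (le_lt_trans _ h1)// lerN2.
rewrite bigcup_itvT.
rewrite probability_setT => /fine_cvgP[_ /cvgrPdist_lt /(_ e e0)[n _ hn]].
exists n%:R => K nK; have := hn n (leqnn n); rewrite /= normal_prob_ocE ?ge0_cp//.
move=> h; have {}h : G n%:R - G (- n%:R) > 1 - e by move: h; rewrite /= ltr_norml; lra.
have := std_normal_cdf_le1 n%:R; have := std_normal_cdf_ge0 (- n%:R).
have : G n%:R <= G K by exact: std_normal_cdf_mono.
have : G (- K) <= G (- n%:R) by apply: std_normal_cdf_mono; rewrite lerN2.
by move=> *; split; lra.
Qed.
End normal_cdf.

(** * Symmetric binomial distributions *)

Section binomial.
Context (R : realType).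

Definition binom_weight p j : R := 'C(p, j)%:R / 2 ^+ p.
Local Notation w := binom_weight.
Local Notation bt := (binom_tail R).

Lemma binom_weight_ge0 p j : 0 <= w p j.
Proof. by rewrite divr_ge0// exprn_ge0. Qed.

Lemma binom_tailE p q : bt p q = \sum_(0 <= j < q) w p j.
Proof. by rewrite /binom_tail natr_sum mulr_suml big_mkord. Qed.

(** Puts the tails for all [q], even beyond [p], over one range of summation, to be compared with
    the total mass and the second moment. *)
Lemma binom_tail_mkcond p q :
  bt p q = \sum_(0 <= j < p.+1) (if (j < q)%N then w p j else 0).
Proof.
have w0 j : (p < j)%N -> w p j = 0 by move=> pj; rewrite /w bin_small// mul0r.
have [qp|pq] := leqP q p.+1.
  rewrite binom_tailE (@big_cat_nat _ _ _ q 0 p.+1)//=.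
  rewrite [X in _ = _ + X]big1_seq ?addr0.
    by apply: eq_big_nat => j /andP[_ ->].
  by move=> j; rewrite mem_index_iota => /andP[_ /andP[qj _]]; rewrite ltnNge qj.
rewrite binom_tailE (@big_cat_nat _ _ _ p.+1 0 q)//= 1?ltnW//.
rewrite [X in _ + X]big1_seq ?addr0.
  by apply: eq_big_nat => j /andP[_ jp]; rewrite (ltn_trans jp).
by move=> j; rewrite mem_index_iota => /andP[_ /andP[pj _]]; rewrite w0.
Qed.

Lemma binom_weight_sum p : \sum_(0 <= j < p.+1) w p j = 1.
Proof.
rewrite big_mkord -mulr_suml -natr_sum.
have -> : (\sum_(i < p.+1) 'C(p, i) = 2 ^ p)%N.
  by rewrite -[2%N]/((1 + 1)%N) expnDn; apply: eq_bigr => i _; rewrite !exp1n !muln1.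
by rewrite natrX divff// expf_neq0// pnatr_eq0.
Qed.

Lemma binom_shift p (F : nat -> R) :
  \sum_(j < p.+2) 'C(p.+1, j)%:R * F j =
  \sum_(j < p.+1) 'C(p, j)%:R * (F j + F j.+1).
Proof.
under [RHS]eq_bigr do rewrite mulrDr.
rewrite big_split /= big_ord_recl bin0 mul1r.
rewrite (eq_bigr (fun i : 'I_p.+1 => 'C(p, i.+1)%:R * F i.+1 + 'C(p, i)%:R * F i.+1)).
  rewrite big_split /= addrA; congr (_ + _).
  rewrite [in RHS]big_ord_recl bin0 mul1r; congr (_ + _).
  by rewrite big_ord_recr /= bin_small// mul0r addr0.
by move=> i _; rewrite /= /bump /= add1n binS natrD mulrDl.
Qed.

(** A further toss changes the deviation [2 j - p] by 1 or -1, which adds 1 to the mean square. *)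
Lemma binom_variance p :
  \sum_(j < p.+1) 'C(p, j)%:R * (2 * j%:R - p%:R) ^+ 2 = p%:R * 2 ^+ p :> R.
Proof.
elim: p => [|p IH].
  by rewrite big_ord_recl big_ord0 /= addr0 mulr0 subrr expr2 !mulr0 mul0r.
rewrite (binom_shift p (fun j => (2 * j%:R - p.+1%:R) ^+ 2)).
rewrite (eq_bigr (fun j : 'I_p.+1 => 2 * ('C(p, j)%:R * (2 * j%:R - p%:R) ^+ 2) +
    2 * 'C(p, j)%:R)); last first.
  by move=> j _; rewrite -!natr1; ring.
rewrite big_split /= -!mulr_sumr IH exprS -[p.+1%:R]natr1.
have := binom_weight_sum p; rewrite big_mkord -mulr_suml => /divr1_eq h.
by rewrite h; ring.
Qed.

Lemma binom_chebyshev p s (A : pred nat) : 0 < s ->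
  (forall j, (j <= p)%N -> A j -> s <= `|2 * j%:R - p%:R|) ->
  \sum_(0 <= j < p.+1) (if A j then w p j else 0) <= p%:R / s ^+ 2.
Proof.
move=> s0 hA; rewrite ler_pdivlMr ?exprn_gt0// mulr_suml.
have -> : (p%:R : R) = \sum_(0 <= j < p.+1) w p j * (2 * j%:R - p%:R) ^+ 2.
  rewrite big_mkord; under eq_bigr do rewrite /w mulrAC.
  by rewrite -mulr_suml binom_variance mulfK// expf_neq0// pnatr_eq0.
apply: ler_sum_nat => j /andP[_ jp]; case: ifPn => Aj; last first.
  by rewrite mul0r mulr_ge0 ?sqr_ge0// binom_weight_ge0.
rewrite ler_wpM2l ?binom_weight_ge0// -[leRHS]real_normK ?num_real//.
by rewrite ler_sqr ?nnegrE ?(ltW s0)// hA.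
Qed.

Lemma binom_tail_small p q s : 0 < s -> 2 * q%:R + s <= p%:R ->
  bt p q <= p%:R / s ^+ 2.
Proof.
move=> s0 h; rewrite binom_tail_mkcond.
apply: (binom_chebyshev (A := fun j => (j < q)%N)) => // j _ jq.
have : (j%:R : R) <= q%:R by rewrite ler_nat ltnW.
by move=> h1; rewrite ler0_norm; lra.
Qed.

Lemma binom_tailC p q :
  1 - bt p q = \sum_(0 <= j < p.+1) (if (q <= j)%N then w p j else 0).
Proof.
rewrite -(binom_weight_sum p) binom_tail_mkcond -sumrB; apply: eq_bigr => j _.
by case: ltnP; rewrite ?subrr ?subr0.
Qed.

Lemma binom_tail_large p q s : 0 < s -> p%:R + s <= 2 * q%:R ->
  1 - bt p q <= p%:R / s ^+ 2.
Proof.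
move=> s0 h; rewrite binom_tailC.
apply: (binom_chebyshev (A := fun j => (q <= j)%N)) => // j _ jq.
have : (q%:R : R) <= j%:R by rewrite ler_nat.
by move=> h1; rewrite ger0_norm; lra.
Qed.

Lemma binom_tail_le1 p q : bt p q <= 1.
Proof.
rewrite -subr_ge0 binom_tailC sumr_ge0// => j _.
by case: ifP => // _; exact: binom_weight_ge0.
Qed.

Lemma binom_tail_ge0 p q : 0 <= bt p q.
Proof. by rewrite divr_ge0// exprn_ge0. Qed.

Lemma binom_tail_mono p a b : (a <= b)%N -> bt p a <= bt p b.
Proof.
move=> ab; rewrite !binom_tailE (@big_cat_nat _ _ _ a 0 b)//= lerDl.
by apply: sumr_ge0 => j _; exact: binom_weight_ge0.
Qed.

Lemma binom_tail_diff p a b : (a <= b)%N ->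
  bt p b - bt p a = \sum_(a <= j < b) w p j.
Proof.
move=> ab; rewrite !binom_tailE (@big_cat_nat _ _ _ a 0 b)//=.
by rewrite addrAC subrr add0r.
Qed.

(** The count [j] centred at the mean [p / 2] and divided by the standard deviation [sqrt p / 2]. *)
Definition std_point p j : R := (2 * j%:R - p%:R) / Num.sqrt p%:R.
Local Notation x := std_point.

(** Up to a constant, the quotient of the binomial weight and the normal density at the standardized
    point. *)
Definition weight_ratio p j : R := w p j * expR (x p j ^+ 2 / 2).
Local Notation u := weight_ratio.

Lemma weight_ratio_ge0 p j : 0 <= u p j.
Proof. by rewrite mulr_ge0 ?expR_ge0 ?binom_weight_ge0. Qed.

Lemma std_pointS p j : x p j.+1 = x p j + 2 / Num.sqrt p%:R.
Proof. by rewrite /x -natr1 -mulrDl; congr (_ / _); ring. Qed.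

Lemma std_point_le p i j : (i <= j)%N -> x p i <= x p j.
Proof.
move=> ij; rewrite ler_wpM2r ?invr_ge0 ?sqrtr_ge0// lerD2r ler_wpM2l//.
by rewrite ler_nat.
Qed.

Lemma onem_expR_bounds (y : R) : `|y| < 1 -> 1 - y ^+ 2 <= (1 - y) * expR y <= 1.
Proof.
rewrite ltr_norml => /andP[y1 y2]; apply/andP; split.
  have -> : 1 - y ^+ 2 = (1 - y) * (1 + y) by ring.
  by rewrite ler_wpM2l ?expR_ge1Dx// subr_ge0 ltW.
have := expR_ge1Dx (- y); rewrite -(ler_pM2r (expR_gt0 y)).
by rewrite -expRD addNr expR0.
Qed.

(** With [y] and [z] the points at [j] and [j.+1] divided by [sqrt p], consecutive weights have
    quotient [(1 - y) / (1 + z)] and the exponents differ by [y + z]. The factors [(1 - y) * expR y]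
    and [(1 + z) * expR (- z)] both lie between [1 - K ^+ 2 / p%:R] and 1. *)
Lemma weight_ratio_step p j K : 0 < K -> K ^+ 2 < p%:R -> (j < p)%N ->
  `|x p j| <= K -> `|x p j.+1| <= K ->
  (1 - K ^+ 2 / p%:R) * u p j <= u p j.+1 /\
  (1 - K ^+ 2 / p%:R) * u p j.+1 <= u p j.
Proof.
move=> K0 Kp jp xj xj1; set sp : R := Num.sqrt p%:R.
have p0 : (0 : R) < p%:R by apply: lt_trans Kp; rewrite exprn_gt0.
have sp0 : 0 < sp by rewrite sqrtr_gt0.
have spE : sp ^+ 2 = p%:R by rewrite sqr_sqrtr// (ltW p0).
pose y := x p j / sp; pose z := x p j.+1 / sp.
have small v : `|v| <= K -> (v / sp) ^+ 2 <= K ^+ 2 / p%:R.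
  move=> vK; rewrite expr_div_n spE ler_wpM2r ?invr_ge0 ?(ltW p0)//.
  by rewrite -[leLHS]real_normK ?num_real// ler_sqr ?nnegrE// (ltW K0).
have K1 : K ^+ 2 / p%:R < 1 by rewrite ltr_pdivrMr// mul1r.
have lt1 v : `|v| <= K -> `|v / sp| < 1.
  move=> /small h; rewrite -(@ltr_pXn2r _ 2)// ?nnegrE// expr1n.
  by rewrite real_normK ?num_real//; exact: le_lt_trans K1.
have /andP[C1 C2] := onem_expR_bounds (lt1 _ xj).
have /andP[B1 B2] : 1 - (- z) ^+ 2 <= (1 - - z) * expR (- z) <= 1.
  by apply: onem_expR_bounds; rewrite normrN; exact: lt1.
rewrite sqrrN opprK in B1 B2; rewrite -/y in C1 C2.
have yS := small _ xj; have zS := small _ xj1; rewrite -/y in yS; rewrite -/z in zS.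
have key : u p j.+1 * ((1 + z) * expR (- z)) = u p j * ((1 - y) * expR y).
  have e1 : w p j.+1 * (1 + z) = w p j * (1 - y).
    have h : (j.+1%:R * 'C(p, j.+1)%:R = (p%:R - j%:R) * 'C(p, j)%:R :> R).
      by rewrite -natrM mul_bin_left natrM natrB// ltnW.
    rewrite /w /z /y /x -!mulrA -!invfM -expr2 spE.
    have -> : 1 + (2 * j.+1%:R - p%:R) / p%:R = 2 / p%:R * j.+1%:R :> R.
      by field; rewrite gt_eqF.
    have -> : 1 - (2 * j%:R - p%:R) / p%:R = 2 / p%:R * (p%:R - j%:R) :> R.
      by field; rewrite gt_eqF.
    transitivity (2 / p%:R / 2 ^+ p * (j.+1%:R * 'C(p, j.+1)%:R) : R); first by ring.
    by rewrite h; ring.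
  have e2 : x p j.+1 ^+ 2 / 2 - z = x p j ^+ 2 / 2 + y.
    rewrite /z /y std_pointS -/sp; field; rewrite gt_eqF//.
  rewrite /u; transitivity (w p j.+1 * (1 + z) * expR (x p j.+1 ^+ 2 / 2 - z)).
    by rewrite expRD; ring.
  by rewrite e1 e2 expRD; ring.
have u0 := weight_ratio_ge0 p j; have u1 := weight_ratio_ge0 p j.+1.
split.
  apply: (@le_trans _ _ (u p j * ((1 - y) * expR y))).
    by rewrite mulrC ler_wpM2l//; lra.
  by rewrite -key ler_piMr.
apply: (@le_trans _ _ (u p j.+1 * ((1 + z) * expR (- z)))).
  by rewrite mulrC ler_wpM2l//; lra.
by rewrite key ler_piMr.
Qed.
End binomial.

(** * Central limit theorem for symmetric binomial laws *)

Section clt.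
Context (R : realType).
Local Notation w := (@binom_weight R).
Local Notation bt := (binom_tail R).
Local Notation x := (@std_point R).
Local Notation u := (@weight_ratio R).
Local Notation G := (@std_normal_cdf R).

Lemma ratio_chain (f : nat -> R) c i j : 0 <= c -> (i <= j)%N ->
  (forall t, (i <= t < j)%N -> c * f t <= f t.+1 /\ c * f t.+1 <= f t) ->
  c ^+ (j - i) * f i <= f j /\ c ^+ (j - i) * f j <= f i.
Proof.
move=> c0 /subnKC <-; rewrite addKn; move: (j - i)%N => m.
elim: m => [|m IH] h; first by rewrite addn0 expr0 !mul1r.
have [|h1 h2] := IH.
  by move=> t /andP[it tm]; apply: h; rewrite it/= addnS ltnW.
have [h3 h4] : c * f (i + m)%N <= f (i + m).+1 /\ c * f (i + m).+1 <= f (i + m)%N.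
  by apply: h; rewrite leq_addr addnS ltnSn.
rewrite addnS; split.
  by rewrite exprS -mulrA; apply: le_trans h3; rewrite ler_wpM2l.
by rewrite exprSr -mulrA; apply: le_trans h2; rewrite ler_wpM2l// exprn_ge0.
Qed.

Lemma bernoulli_ineq (a : R) m : 0 <= a <= 1 -> 1 - m%:R * a <= (1 - a) ^+ m.
Proof.
move=> /andP[a0 a1]; elim: m => [|m IH]; first by rewrite mul0r subr0 expr0.
have h : (1 - m%:R * a) * (1 - a) <= (1 - a) ^+ m.+1.
  by rewrite exprSr ler_wpM2r// subr_ge0.
apply: le_trans h; rewrite -natr1; have : 0 <= m%:R * a ^+ 2 :> R.
  by rewrite mulr_ge0// sqr_ge0.
by lra.
Qed.

(* On the window [|x_j| <= K] the weights and the normal masses of the cells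
   ]x_j, x_(j+1)] are proportional, up to a factor [theta] close to 1. *)
Section window.
Context (p l r : nat) (K : R).
Hypotheses (K0 : 0 < K) (Kp : K ^+ 2 < p%:R) (lr : (l <= r)%N) (rp : (r <= p)%N)
  (xl : - K <= x p l) (xr : x p r <= K).

Let sp : R := Num.sqrt p%:R.
Let mass j := G (x p j.+1) - G (x p j).
Let a := K ^+ 2 / p%:R.
(** The power accounts for the drift of [weight_ratio] across the window, the exponential for the
    variation of the density within two cells. *)
Let theta := (1 - a) ^+ (r - l) * expR (- (2 * K * (2 / sp))).

Let p0 : (0 : R) < p%:R.
Proof. by apply: lt_trans Kp; rewrite exprn_gt0. Qed.

Let sp0 : 0 < sp. Proof. by rewrite sqrtr_gt0. Qed.

Let a01 : 0 <= a <= 1.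
Proof.
by rewrite /a divr_ge0 ?sqr_ge0//= ler_pdivrMr// mul1r ltW.
Qed.

Let in_window j : (l <= j <= r)%N -> `|x p j| <= K.
Proof.
move=> /andP[lj jr]; rewrite ler_norml (le_trans xl)/= ?std_point_le//.
by rewrite (le_trans _ xr)// std_point_le.
Qed.

Let ratio_compare i j : (l <= i <= r)%N -> (l <= j <= r)%N ->
  (1 - a) ^+ (r - l) * u p i <= u p j.
Proof.
have c0 : 0 <= 1 - a by case/andP: a01; rewrite subr_ge0.
have c1 : 1 - a <= 1 by case/andP: a01 => h _; rewrite lerBlDr lerDl.
have key b c : (l <= b)%N -> (b <= c)%N -> (c <= r)%N ->
    (1 - a) ^+ (r - l) * u p b <= u p c /\ (1 - a) ^+ (r - l) * u p c <= u p b.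
  move=> lb bc cr; have [|h1 h2] := @ratio_chain (u p) (1 - a) b c c0 bc.
    move=> t /andP[bt tc]; apply: weight_ratio_step => //.
    - by rewrite (leq_trans tc)// (leq_trans cr).
    - by apply: in_window; rewrite (leq_trans lb)//= (leq_trans (ltnW tc)).
    - by apply: in_window; rewrite (leq_trans lb)/= ?(leq_trans tc)// ltnW.
  have le : (1 - a) ^+ (r - l) <= (1 - a) ^+ (c - b).
    by apply: ler_wiXn2l => //; exact: leq_sub.
  by split; [apply: le_trans h1|apply: le_trans h2];
    rewrite ler_wpM2r// weight_ratio_ge0.
move=> /andP[li ir] /andP[lj jr]; have [ij|ji] := leqP i j.
  by case: (key i j li ij jr).
by case: (key j i lj (ltnW ji) ir).
Qed.

(** Within a cell of length [2 / sp] in the window, half of the squared argument varies by at most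
    [K * (2 / sp)]. *)
Let mass_bounds j : (l <= j < r)%N ->
  normal_peak 1 * (2 / sp) * expR (- (x p j ^+ 2 / 2)) * expR (- (K * (2 / sp)))
    <= mass j <=
  normal_peak 1 * (2 / sp) * expR (- (x p j ^+ 2 / 2)) * expR (K * (2 / sp)).
Proof.
move=> /andP[lj jr]; have xS := std_pointS R p j; rewrite -/sp in xS.
have h0 : 0 < 2 / sp by rewrite divr_gt0.
have n1 : `|x p j| <= K by apply: in_window; rewrite lj ltnW.
have n2 : `|x p j.+1| <= K by apply: in_window; rewrite jr (leq_trans lj).
pose e := expR (- (x p j ^+ 2 / 2)).
have /andP[h1 h2] : (normal_peak 1 * e * expR (- (K * (2 / sp)))) *
    (x p j.+1 - x p j) <= mass j <= (normal_peak 1 * e * expR (K * (2 / sp))) *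
    (x p j.+1 - x p j).
  apply: std_normal_cdf_increment.
  - by rewrite xS lerDl ltW.
  - by rewrite !mulr_ge0 ?expR_ge0// normal_peak_ge0.
  move=> t /andP[t1 t2]; rewrite std_normal_pdfE -!mulrA.
  have bnd : `|t ^+ 2 / 2 - x p j ^+ 2 / 2| <= K * (2 / sp).
    have -> : t ^+ 2 / 2 - x p j ^+ 2 / 2 = (t + x p j) / 2 * (t - x p j) by field.
    rewrite normrM ler_pM//.
      by move: n1 n2; rewrite !ler_norml; lra.
    by rewrite ger0_norm; lra.
  move: bnd; rewrite ler_norml => /andP[b1 b2].
  rewrite !ler_pM2l ?normal_peak_gt0 ?oner_eq0// /e -!expRD !ler_expR.
  by apply/andP; split; lra.
have xd : x p j.+1 - x p j = 2 / sp by rewrite xS addrC addKr.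
rewrite xd in h1 h2; rewrite -/e; apply/andP; split.
  by apply: le_trans h1; rewrite le_eqVlt; apply/orP; left; apply/eqP; ring.
by apply: le_trans h2 _; rewrite le_eqVlt; apply/orP; left; apply/eqP; ring.
Qed.

(** A comparison of the quotients of weight and mass at [i] and [j], cross-multiplied so that it can
    be summed over both indices. *)
Let weight_compare i j : (l <= i < r)%N -> (l <= j < r)%N ->
  theta * w p j * mass i <= w p i * mass j.
Proof.
move=> hi hj; have /andP[_ mi] := mass_bounds hi; have /andP[mj _] := mass_bounds hj.
have iw : (l <= i <= r)%N by case/andP: hi => -> /ltnW.
have jw : (l <= j <= r)%N by case/andP: hj => -> /ltnW.
have uu := ratio_compare jw iw.
set c := normal_peak 1 * (2 / sp) in mi mj.
have c0 : 0 <= c by rewrite mulr_ge0 ?normal_peak_ge0// divr_ge0// ltW.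
set ei := expR (- (x p i ^+ 2 / 2)) in mi.
set ej := expR (- (x p j ^+ 2 / 2)) in mj.
set E := expR (- (K * (2 / sp))) in mj.
set E' := expR (K * (2 / sp)) in mi.
have wE t : w p t = u p t * expR (- (x p t ^+ 2 / 2)).
  by rewrite /weight_ratio -mulrA -expRD subrr expR0 mulr1.
have th : theta * E' = (1 - a) ^+ (r - l) * E.
  rewrite /theta /E /E' -mulrA -expRD; congr (_ * expR _).
  by ring.
have th0 : 0 <= theta.
  rewrite mulr_ge0 ?expR_ge0// exprn_ge0//; case/andP: a01; rewrite subr_ge0.
  by [].
apply: (@le_trans _ _ (theta * w p j * (c * ei * E'))).
  by rewrite ler_wpM2l// mulr_ge0// binom_weight_ge0.
apply: (@le_trans _ _ (w p i * (c * ej * E))); last first.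
  by rewrite ler_wpM2l// binom_weight_ge0.
have -> : theta * w p j * (c * ei * E') = ((1 - a) ^+ (r - l) * u p j) * (c * ei * ej * E).
  transitivity (theta * E' * (w p j * c * ei)); first by ring.
  by rewrite th wE -/ej; ring.
have -> : w p i * (c * ej * E) = u p i * (c * ei * ej * E) by rewrite wE -/ei; ring.
rewrite ler_wpM2r//; apply: mulr_ge0; last exact: expR_ge0.
apply: mulr_ge0; last exact: expR_ge0.
by apply: mulr_ge0 => //; exact: expR_ge0.
Qed.

Let mass_sum i j : (i <= j)%N -> \sum_(i <= t < j) mass t = G (x p j) - G (x p i).
Proof. by move=> ij; exact: (telescope_sumr (fun t => G (x p t)) ij). Qed.

(** Summing [weight_compare] over the cells of the part and of the whole window compares the shares
    that the part has under both laws. *)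
Lemma window_compare i j : (l <= i)%N -> (i <= j)%N -> (j <= r)%N ->
  theta * (bt p r - bt p l) * (G (x p j) - G (x p i)) <=
  (bt p j - bt p i) * (G (x p r) - G (x p l)).
Proof.
move=> li ij jr; rewrite -!mass_sum// !binom_tail_diff//.
rewrite mulr_sumr [leRHS]mulr_suml mulr_sumr.
apply: ler_sum_nat => t /andP[it tj]; rewrite mulr_sumr mulr_suml.
apply: ler_sum_nat => s /andP[ls sr]; apply: weight_compare.
  by rewrite (leq_trans li it) (leq_trans tj jr).
by rewrite ls sr.
Qed.

(** At most [K * sp] steps that each lose [K ^+ 2 / p%:R] cost [K ^+ 3 / sp] by Bernoulli's
    inequality; the exponential costs [4 * K / sp]. *)
Lemma theta_ge : r%:R - l%:R <= K * sp -> 1 - (K ^+ 3 + 4 * K) / sp <= theta.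
Proof.
move=> rl; have spE : sp ^+ 2 = p%:R by rewrite sqr_sqrtr// ltW.
have A : 1 - K ^+ 3 / sp <= (1 - a) ^+ (r - l).
  apply: le_trans (bernoulli_ineq _ a01); rewrite lerD2l lerN2 natrB//.
  apply: (@le_trans _ _ (K * sp * a)).
    by rewrite ler_wpM2r//; case/andP: a01.
  by rewrite /a -spE le_eqVlt; apply/orP; left; apply/eqP; field; rewrite gt_eqF.
have B : 1 - 4 * K / sp <= expR (- (2 * K * (2 / sp))).
  apply: le_trans (expR_ge1Dx _); rewrite le_eqVlt; apply/orP; left; apply/eqP.
  by field; rewrite gt_eqF.
have A1 : (1 - a) ^+ (r - l) <= 1.
  by apply: exprn_ile1; case/andP: a01; lra.
have A0 : 0 <= (1 - a) ^+ (r - l) by apply: exprn_ge0; case/andP: a01; lra.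
have B0 : 0 <= 4 * K / sp by rewrite !mulr_ge0 ?invr_ge0 ?ltW.
rewrite /theta mulrDl; nra.
Qed.
End window.
End clt.

Section clt.
Context (R : realType).
Local Notation bt := (binom_tail R).
Local Notation x := (@std_point R).
Local Notation G := (@std_normal_cdf R).

(** Lower bounds for binomial masses suffice: the stretch from [l] to [q] bounds the tail from
    below, the one from [q] to [r] from above, because the total mass is 1. *)
Lemma binom_tail_normal_bound p q (K : R) :
  0 < K -> K < Num.sqrt p%:R -> 4 <= K * Num.sqrt p%:R -> `|x p q| <= K / 2 ->
  `|bt p q - G (x p q)| <=
  G (- (K / 2)) + (1 - G (K / 2)) + ((K ^+ 3 + 4 * K) / Num.sqrt p%:R + 8 / K ^+ 2).
Proof.
set sp := Num.sqrt p%:R => K0 Ksp K4 xq.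
have sp0 : 0 < sp by exact: lt_trans Ksp.
have p0 : (0 : R) < p%:R by rewrite -sqrtr_gt0.
have spE : sp ^+ 2 = p%:R by rewrite sqr_sqrtr// (ltW p0).
have Kp : K ^+ 2 < p%:R by rewrite -spE ltr_pXn2r// nnegrE ltW.
have Kspp : K * sp <= p%:R by rewrite -spE expr2 ler_wpM2r// ltW.
have xE t : 2 * t%:R - p%:R = x p t * sp by rewrite /std_point divfK// gt_eqF.
(* The standardized window reaches from a point between [-K] and [-K/2] to one between [K/2] and
   [K]; the hypothesis [4 <= K * sp] leaves room for the rounding. *)
pose l := (Num.trunc ((p%:R - K * sp) / 2)).+1.
pose r := Num.trunc ((p%:R + K * sp) / 2).
have Ksp0 : 0 < K * sp by rewrite mulr_gt0.
have [l1 l2] : - (K * sp) <= 2 * l%:R - p%:R /\ 2 * l%:R - p%:R <= - (K / 2 * sp).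
  have h1 := truncnS_gt ((p%:R - K * sp) / 2).
  have h2 : (Num.trunc ((p%:R - K * sp) / 2))%:R <= (p%:R - K * sp) / 2.
    by rewrite truncn_le// divr_ge0// subr_ge0.
  by rewrite -[(Num.trunc _).+1%:R]natr1 in h1; rewrite /l -[(Num.trunc _).+1%:R]natr1; split; lra.
have [r1 r2] : 2 * r%:R - p%:R <= K * sp /\ K / 2 * sp <= 2 * r%:R - p%:R.
  have h1 := truncnS_gt ((p%:R + K * sp) / 2).
  have h2 : (Num.trunc ((p%:R + K * sp) / 2))%:R <= (p%:R + K * sp) / 2.
    by rewrite truncn_le// divr_ge0// addr_ge0// ltW.
  by rewrite -[(Num.trunc _).+1%:R]natr1 in h1; rewrite /r; split; lra.
move: xq; rewrite ler_norml => /andP[xq1 xq2].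
have lq : (l <= q)%N.
  rewrite -(ler_nat R); have := xE q; have : - (K / 2) * sp <= x p q * sp.
    by rewrite ler_wpM2r// ltW.
  by lra.
have qr : (q <= r)%N.
  rewrite -(ler_nat R); have := xE q; have : x p q * sp <= K / 2 * sp.
    by rewrite ler_wpM2r// ltW.
  by lra.
have rp : (r <= p)%N by rewrite -(ler_nat R); lra.
have toX c t : c * sp <= 2 * t%:R - p%:R -> c <= x p t.
  by rewrite xE ler_pM2r.
have toX' c t : 2 * t%:R - p%:R <= c * sp -> x p t <= c.
  by rewrite xE ler_pM2r.
have xl : - K <= x p l by apply: toX; rewrite mulNr.
have xl' : x p l <= - (K / 2) by apply: toX'; rewrite mulNr.
have xr : x p r <= K by exact: toX'.
have xr' : K / 2 <= x p r by exact: toX.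
(* Chebyshev's bound at [K / 2 * sp]; the two tails together account for the error [8 / K ^+ 2]. *)
have tails : p%:R / (K / 2 * sp) ^+ 2 = 4 / K ^+ 2.
  by rewrite exprMn spE; field; rewrite !gt_eqF.
have s0 : 0 < K / 2 * sp by rewrite !mulr_gt0// invr_gt0.
have bl : bt p l <= 4 / K ^+ 2.
  by rewrite -tails; apply: binom_tail_small => //; lra.
have br : 1 - bt p r <= 4 / K ^+ 2.
  by rewrite -tails; apply: binom_tail_large => //; lra.
have rl : r%:R - l%:R <= K * sp by lra.
have th := theta_ge K0 Kp (leq_trans lq qr) rl.
have cmp i j := window_compare K0 Kp (leq_trans lq qr) rp xl xr (i := i) (j := j).
rewrite -/sp in th.
set theta := _ ^+ _ * expR _ in th cmp.
pose T := (K ^+ 3 + 4 * K) / sp; rewrite -/T in th.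
have T0 : 0 <= T by rewrite divr_ge0 ?addr_ge0 ?exprn_ge0 ?mulr_ge0 ?ltW.
pose B := 8 / K ^+ 2; have BE : B = 4 / K ^+ 2 + 4 / K ^+ 2 by rewrite /B; lra.
have key i j : (l <= i)%N -> (i <= j)%N -> (j <= r)%N ->
    G (x p j) - G (x p i) - (T + B) <= bt p j - bt p i.
  move=> li ij jr; have := cmp i j li ij jr.
  have D0 : 0 <= G (x p j) - G (x p i).
    by rewrite subr_ge0 std_normal_cdf_mono// std_point_le.
  have D1 : G (x p j) - G (x p i) <= 1.
    by have := std_normal_cdf_le1 (x p j); have := std_normal_cdf_ge0 (x p i); lra.
  have D2 : G (x p r) - G (x p l) <= 1.
    by have := std_normal_cdf_le1 (x p r); have := std_normal_cdf_ge0 (x p l); lra.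
  have W0 : 0 <= bt p j - bt p i by rewrite subr_ge0 binom_tail_mono.
  have W1 : 1 - B <= bt p r - bt p l by lra.
  have W2 : bt p r - bt p l <= 1.
    by have := binom_tail_le1 R p r; have := binom_tail_ge0 R p l; lra.
  have W3 : 0 <= bt p r - bt p l by rewrite subr_ge0 binom_tail_mono// (leq_trans lq qr).
  set D := G (x p j) - G (x p i) in D0 D1 *; set W := bt p r - bt p l in W1 W2 W3 *.
  set V := bt p j - bt p i in W0 *; set D' := G (x p r) - G (x p l) in D2 *.
  move=> h; have h1 : V * D' <= V by rewrite ler_piMr.
  have h2 : (1 - T) * (W * D) <= theta * (W * D) by rewrite ler_wpM2r// mulr_ge0.
  have h3 : W * D <= 1 by rewrite mulr_ile1.
  have h4 : (1 - W) * D <= 1 - W by rewrite ler_piMr// subr_ge0.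
  have h5 : T * (W * D) <= T by rewrite ler_piMr.
  by lra.
have k1 := key l q (leqnn l) lq qr; have k2 := key q r lq qr (leqnn r).
have := std_normal_cdf_mono xl'; have := std_normal_cdf_mono xr'.
have := binom_tail_le1 R p r; have := binom_tail_ge0 R p l.
have := std_normal_cdf_ge0 (- (K / 2)); have := std_normal_cdf_le1 (K / 2).
rewrite ler_norml -/T -/B => *; apply/andP; split; lra.
Qed.

Lemma binom_tail_cvg (p q : nat -> nat) (c : R) :
  ((p d)%:R : R) @[d --> \oo] --> +oo -> x (p d) (q d) @[d --> \oo] --> c ->
  bt (p d) (q d) @[d --> \oo] --> G c.
Proof.
move=> /cvgryPge hp /cvgrPdist_le hx; apply/cvgrPdist_le => e e0.
have e8 : 0 < e / 8 by rewrite divr_gt0.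
have [M hM] := std_normal_cdf_tails e8.
(* The first summand covers the normal tails and the points near [c]; the second makes [8 / K ^+ 2]
   at most [e / 8]. *)
pose K := 2 * (`|M| + `|c| + 1) + 64 / e.
have e64 : 0 < 64 / e by rewrite divr_gt0.
have nM := normr_ge0 M; have nc := normr_ge0 c; have leM := ler_norm M.
have K1 : 1 <= K by rewrite /K; lra.
have K0 : 0 < K by lra.
have [t1 t2] : G (- (K / 2)) <= e / 8 /\ 1 - G (K / 2) <= e / 8.
  by apply: hM; rewrite /K; lra.
have t3 : 8 / K ^+ 2 <= e / 8.
  apply: (@le_trans _ _ (8 / K)).
    by rewrite ler_wpM2l// lef_pV2 ?posrE ?exprn_gt0// expr2 ler_peMr// ltW.
  rewrite ler_pdivrMr//; apply: (@le_trans _ _ (e / 8 * (64 / e))).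
    by rewrite le_eqVlt; apply/orP; left; apply/eqP; field; rewrite gt_eqF.
  by rewrite ler_wpM2l ?(ltW e8)// /K; lra.
(* A lower bound for [sqrt p] that gives [K < sp] and [4 <= K * sp], and brings the error of [theta]
   below [e / 8]. *)
pose B := K + 1 + 4 + (K ^+ 3 + 4 * K) * (8 / e).
have K3 : 0 <= K ^+ 3 + 4 * K by rewrite addr_ge0 ?exprn_ge0 ?mulr_ge0 ?ltW.
have B2 : 0 <= (K ^+ 3 + 4 * K) * (8 / e) by rewrite mulr_ge0// divr_ge0// ltW.
have B0 : 0 < B by rewrite /B; lra.
pose pk : R := normal_peak 1; have pk0 : 0 <= pk by exact: normal_peak_ge0.
(* The bound 1 keeps the points within [K / 2]; the other one makes the Lipschitz error at most
   [e / 8]. *)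
pose eta := Num.min 1 (e / (8 * (pk + 1))).
have eta0 : 0 < eta by rewrite lt_min ltr01/= divr_gt0// mulr_gt0// ltr_wpDl.
near=> d.
have pB : B ^+ 2 <= (p d)%:R by near: d; exact: hp.
have xc : `|c - x (p d) (q d)| <= eta by near: d; exact: hx.
have spB : B <= Num.sqrt (p d)%:R.
  by rewrite -[B]ger0_norm ?(ltW B0)// -sqrtr_sqr ler_wsqrtr.
set sp := Num.sqrt (p d)%:R in spB.
have sp0 : 0 < sp by exact: lt_le_trans spB.
have eta1 : eta <= 1 by rewrite ge_min lexx.
have etae : pk * eta <= e / 8.
  apply: (@le_trans _ _ ((pk + 1) * (e / (8 * (pk + 1))))).
    apply: ler_pM => //; [exact: ltW|lra|by rewrite ge_min lexx orbT].
  by rewrite le_eqVlt; apply/orP; left; apply/eqP; field; rewrite gt_eqF// ltr_wpDl.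
have bnd : `|bt (p d) (q d) - G (x (p d) (q d))| <=
  G (- (K / 2)) + (1 - G (K / 2)) + ((K ^+ 3 + 4 * K) / sp + 8 / K ^+ 2).
  apply: binom_tail_normal_bound => //; rewrite -/sp.
  - by apply: lt_le_trans spB; rewrite /B; lra.
  - rewrite -[leLHS]mul1r ler_pM//; apply: le_trans spB; rewrite /B; lra.
  - have := ler_normB (c - x (p d) (q d)) c; rewrite addrAC subrr add0r normrN.
    by rewrite /K; lra.
have t4 : (K ^+ 3 + 4 * K) / sp <= e / 8.
  rewrite ler_pdivrMr//; apply: (@le_trans _ _ (e / 8 * ((K ^+ 3 + 4 * K) * (8 / e)))).
    by rewrite le_eqVlt; apply/orP; left; apply/eqP; field; rewrite gt_eqF.
  by rewrite ler_wpM2l ?(ltW e8)//; apply: le_trans spB; rewrite /B; lra.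
have lip := std_normal_cdf_lipschitz c (x (p d) (q d)).
have lip' : `|G c - G (x (p d) (q d))| <= e / 8.
  by apply: le_trans lip _; apply: le_trans etae; rewrite ler_wpM2l.
have := ler_normD (G c - G (x (p d) (q d))) (G (x (p d) (q d)) - bt (p d) (q d)).
rewrite addrA subrK [X in _ <= _ + X]distrC => h; lra.
Unshelve. all: by end_near.
Qed.
End clt.

(** * Limits *)

Lemma powR_natr_cvgy (R : realType) (b : R) : 0 < b ->
  (d%:R : R) `^ b @[d --> \oo] --> +oo.
Proof.
move=> b0; apply/cvgryPge => A; near=> d.
have h : (`|A| + 1) `^ b^-1 <= d%:R :> R.
  by near: d; exact: (nbhs_infty_ger _).
apply: (@le_trans _ _ (((`|A| + 1) `^ b^-1) `^ b)).
  rewrite -powRrM mulVf ?gt_eqF// powRr1 ?addr_ge0//.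
  by have := ler_norm A; lra.
by apply: (ge0_ler_powR (ltW b0)); rewrite ?nnegrE ?powR_ge0.
Unshelve. all: by end_near.
Qed.

Lemma binom_tail_sym (R : realType) p q : (q <= p.+1)%N ->
  1 - binom_tail R p q = binom_tail R p (p.+1 - q).
Proof.
move=> qp; rewrite binom_tailC binom_tail_mkcond big_nat_rev /= add0n.
apply: eq_big_nat => j /andP[_ jp]; rewrite subSS /binom_weight.
rewrite bin_sub -1?ltnS//; congr (if _ then _ else _).
by apply/idP/idP; lia.
Qed.

(** Obtained from the central limit theorem: in [2 d + 1] tosses, fewer than [d + 1] heads have
    probability exactly one half, and the standardized point tends to 0. *)
Lemma std_normal_cdf0 (R : realType) : std_normal_cdf (0 : R) = 2^-1.
Proof.
have h d : binom_tail R d.*2.+1 d.+1 = 2^-1.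
  have := @binom_tail_sym R d.*2.+1 d.+1; rewrite (_ : _.+2 - _ = d.+1)%N; last by lia.
  by move=> /(_ ltac:(lia)); lra.
have hp : (d.*2.+1%:R : R) @[d --> \oo] --> +oo.
  apply/cvgryPge => A; near=> d.
  have : A <= d%:R by near: d; exact: nbhs_infty_ger.
  by move=> /le_trans; apply; rewrite ler_nat; lia.
have hx : std_point R d.*2.+1 d.+1 @[d --> \oo] --> (0 : R).
  have -> : (fun d => std_point R d.*2.+1 d.+1) =
            (fun d => (Num.sqrt (d.*2.+1%:R : R))^-1).
    apply/funext => d; rewrite /std_point -[RHS]mul1r; congr (_ / _).
    by rewrite -mul2n -[in X in _ - X]natr1 -[d.+1%:R]natr1 natrM; ring.
  apply/gtr0_cvgV0; first by near=> d; rewrite sqrtr_gt0.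
  apply/cvgryPge => A; near=> d.
  have : `|A| ^+ 2 <= (d.*2.+1%:R : R).
    near: d; move/cvgryPge : hp; exact.
  move=> /ler_wsqrtr; rewrite sqrtr_sqr normr_id; apply: le_trans.
  exact: ler_norm.
have := binom_tail_cvg hp hx; under eq_cvg do rewrite h.
by move=> /(cvg_unique _ (@cvg_cst _ _ _ _ _)) ->.
Unshelve. all: by end_near.
Qed.

(** * Thresholds many standard deviations away from the mean *)

Section extreme_tails.
Context (R : realType) (p q : nat -> nat) (C c alpha : R).
Hypotheses (C0 : 0 < C) (c0 : 0 < c) (alpha_gt : 1 / 2 < alpha)
  (pC : \forall d \near \oo, (p d)%:R <= C * d%:R).

Let chebyshev_bound_cvg0 :
  C / c ^+ 2 / ((d%:R : R) `^ (2 * alpha - 1)) @[d --> \oo] --> (0 : R).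
Proof.
rewrite -[X in _ --> X](mulr0 (C / c ^+ 2)); apply: cvgM; first exact: cvg_cst.
have h : (d%:R : R) `^ (2 * alpha - 1) @[d --> \oo] --> +oo.
  by apply: powR_natr_cvgy; move: alpha_gt; lra.
apply/gtr0_cvgV0 => //; near=> d; rewrite powR_gt0// ltr0n.
by near: d; exists 1%N.
Unshelve. all: by end_near.
Qed.

Let chebyshev_bound d : (0 < d)%N -> (p d)%:R <= C * d%:R ->
  (p d)%:R / (c * d%:R `^ alpha) ^+ 2 <= C / c ^+ 2 / (d%:R `^ (2 * alpha - 1)).
Proof.
move=> d0 h; have dR : (0 : R) < d%:R by rewrite ltr0n.
have P0 : 0 < d%:R `^ alpha :> R by rewrite powR_gt0.
have -> : d%:R `^ (2 * alpha - 1) = (d%:R `^ alpha) ^+ 2 / d%:R :> R.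
  rewrite powRB; last by rewrite (gt_eqF dR) implybT.
  by rewrite powRr1 ?ler0n// -powR_mulrn ?powR_ge0// -powRrM [alpha * _]mulrC.
rewrite ler_pdivrMr ?exprn_gt0 ?mulr_gt0//.
apply: le_trans h _; rewrite le_eqVlt; apply/orP; left; apply/eqP.
by field; rewrite !gt_eqF.
Qed.

Lemma binom_tail_cvg1 :
  (\forall d \near \oo, (p d)%:R + c * d%:R `^ alpha <= 2 * (q d)%:R) ->
  binom_tail R (p d) (q d) @[d --> \oo] --> (1 : R).
Proof.
move=> hq; have h : 1 - C / c ^+ 2 / ((d%:R : R) `^ (2 * alpha - 1))
    @[d --> \oo] --> (1 : R).
  rewrite -[X in _ --> X]subr0; apply: cvgB; first exact: cvg_cst.
  exact: chebyshev_bound_cvg0.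
apply: squeeze_cvgr; [|exact: h|exact: cvg_cst]; near=> d.
have d0 : (0 < d)%N by near: d; exists 1%N.
rewrite binom_tail_le1 andbT lerBlDr -lerBlDl.
apply: le_trans (chebyshev_bound d0 _); last by near: d.
apply: binom_tail_large; first by rewrite mulr_gt0// powR_gt0// ltr0n.
by near: d.
Unshelve. all: by end_near.
Qed.

Lemma binom_tail_cvg0 :
  (\forall d \near \oo, 2 * (q d)%:R + c * d%:R `^ alpha <= (p d)%:R) ->
  binom_tail R (p d) (q d) @[d --> \oo] --> (0 : R).
Proof.
move=> hq; apply: squeeze_cvgr; [|exact: cvg_cst|exact: chebyshev_bound_cvg0]; near=> d.
have d0 : (0 < d)%N by near: d; exists 1%N.
rewrite binom_tail_ge0 /=.
apply: le_trans (chebyshev_bound d0 _); last by near: d.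
apply: binom_tail_small; first by rewrite mulr_gt0// powR_gt0// ltr0n.
by near: d.
Unshelve. all: by end_near.
Qed.
End extreme_tails.

Unset Implicit Arguments.
Set Strict Implicit.

Theorem theorem2 (R : realType)
    (phi : forall d : nat, probability (borel_rV R d) R)
    (phi_even : forall d, even_measure (phi d))
    (phi_hyperplane : forall d, null_on_hyperplanes (phi d))
    (delta rho : R)
    (delta_gt : 1 / 2 < delta) (delta_lt : delta < 1)
    (rho_def : rho = 2 - 1 / delta)
    (k N : nat -> nat)
    (kdN : \forall d \near \oo, [/\ (1 <= k d)%N, (k d < d)%N & (d < N d)%N])
    (N_lim : (d%:R / (N d)%:R : R) @[d --> \oo] --> delta)
    (k_lim : ((k d)%:R / d%:R : R) @[d --> \oo] --> rho)
    (disp : nat -> measure_display)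
    (Omega : forall d : nat, measurableType (disp d))
    (P : forall d : nat, probability (Omega d) R)
    (X : forall d : nat, 'I_(N d) -> {mfun Omega d >-> borel_rV R d})
    (X_iid : forall d, iid_with_law (P d) (phi d) (X d)) :
  let gap (d : nat) : R := (N d)%:R - 2 * d%:R + (k d)%:R in
  let ratio (d : nat) : R :=
    cover_efron_mean_faces (P d) (X d) (k d) / ('C(N d, k d))%:R in
  [/\ (forall c : R,
        gap d / Num.sqrt (d%:R : R) @[d --> \oo] --> c ->
        let p := std_normal_cdf (- (c / Num.sqrt (2 * (1 - rho)))) in
        ratio d @[d --> \oo] --> p /\ 0 < p < 1),
      (forall c alpha : R, 1 / 2 < alpha -> alpha < 1 -> 0 < c ->
        (\forall d \near \oo, c * (d%:R `^ alpha) <= gap d) ->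
        ratio d @[d --> \oo] --> (0 : R)),
      (forall c alpha : R, 0 < alpha -> alpha < 1 / 2 -> 0 <= c ->
        (\forall d \near \oo,
           - c * (d%:R `^ alpha) <= gap d <= c * (d%:R `^ alpha)) ->
        ratio d @[d --> \oo] --> (1 / 2 : R))
    & (forall c alpha : R, 1 / 2 < alpha -> alpha < 1 -> c < 0 ->
        (\forall d \near \oo, gap d <= c * (d%:R `^ alpha)) ->
        ratio d @[d --> \oo] --> (1 : R))].
Proof.
move=> gap ratio.
(* The parameters of the binomial tail in the numerator of the face ratio. *)
pose p1 d := (N d - k d).-1; pose q1 d := (d - k d)%N.
have delta0 : 0 < delta by lra.
have rho1 : 0 < 1 - rho.
  by rewrite rho_def; have : 1 < 1 / delta; [rewrite ltr_pdivlMr// mul1r|lra].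
have rho0 : 0 < rho.
  by rewrite rho_def; have : 1 / delta < 2; [rewrite ltr_pdivrMr//; lra|lra].
have N1_lim : ((N d)%:R / d%:R : R) @[d --> \oo] --> 2 - rho.
  have -> : 2 - rho = delta^-1 by rewrite rho_def; lra.
  rewrite (_ : (fun d => _) = (fun d => (d%:R / (N d)%:R : R)^-1)).
    by apply: cvgV => //; rewrite gt_eqF.
  by apply/funext => d; rewrite invf_div.
have inv_lim : (d%:R^-1 : R) @[d --> \oo] --> (0 : R).
  apply/gtr0_cvgV0; last exact: cvgr_idn.
  by near=> d; rewrite ltr0n; near: d; exists 1%N.
have p1E : \forall d \near \oo, (p1 d)%:R = (N d)%:R - (k d)%:R - 1 :> R.
  near=> d; have [k1 kd dN] : [/\ (1 <= k d)%N, (k d < d)%N & (d < N d)%N].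
    by near: d.
  have kN := ltn_trans kd dN.
  by rewrite /p1 -subn1 !natrB ?subn_gt0// ltnW.
have q1E : \forall d \near \oo, (q1 d)%:R = d%:R - (k d)%:R :> R.
  near=> d; have [k1 kd dN] : [/\ (1 <= k d)%N, (k d < d)%N & (d < N d)%N].
    by near: d.
  by rewrite /q1 natrB// ltnW.
have p1_lim : ((p1 d)%:R / d%:R : R) @[d --> \oo] --> 2 * (1 - rho).
  have -> : 2 * (1 - rho) = 2 - rho - rho - 0 by ring.
  have h : ((N d)%:R / d%:R - (k d)%:R / d%:R - d%:R^-1 : R) @[d --> \oo] -->
      2 - rho - rho - 0 by apply: cvgB => //; exact: cvgB.
  apply: cvg_trans h; apply: near_eq_cvg; near=> d.
  have -> : (p1 d)%:R = (N d)%:R - (k d)%:R - 1 :> R by near: d.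
  by rewrite !mulrBl div1r.
have N3 : \forall d \near \oo, (N d)%:R <= 3 * d%:R :> R.
  near=> d; have d0 : (0 : R) < d%:R by rewrite ltr0n; near: d; exists 1%N.
  rewrite -ler_pdivrMr//; near: d.
  by apply: (cvgr_le _ N1_lim); lra.
have num_bound : \forall d \near \oo, (p1 d)%:R <= 3 * d%:R :> R.
  near=> d; have -> : (p1 d)%:R = (N d)%:R - (k d)%:R - 1 :> R by near: d.
  have : (N d)%:R <= 3 * d%:R :> R by near: d.
  have : (0 : R) <= (k d)%:R by [].
  by lra.
(* Since [N / d] tends to [2 - rho < 2], twice the threshold [d] exceeds the number of tosses by a
   linear amount, hence the exponent 1. *)
have denom : binom_tail R (N d).-1 d @[d --> \oo] --> (1 : R).
  apply: (@binom_tail_cvg1 R (fun d => (N d).-1) (fun d => d) 3 (rho / 2) 1) => //.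
  - by rewrite divr_gt0.
  - by lra.
  - near=> d; have : (N d)%:R <= 3 * d%:R :> R by near: d.
    by apply: le_trans; rewrite ler_nat leq_pred.
  near=> d; have d0 : (0 : R) < d%:R by rewrite ltr0n; near: d; exists 1%N.
  rewrite powRr1 ?ler0n//.
  have h : (N d)%:R / d%:R <= 2 - rho / 2 :> R.
    by near: d; apply: (cvgr_le _ N1_lim); lra.
  rewrite ler_pdivrMr// in h.
  have h' : ((N d).-1)%:R <= (N d)%:R :> R by rewrite ler_nat leq_pred.
  by lra.
have ratioE : \forall d \near \oo,
    binom_tail R (p1 d) (q1 d) / binom_tail R (N d).-1 d = ratio d.
  near=> d; have [k1 kd dN] : [/\ (1 <= k d)%N, (k d < d)%N & (d < N d)%N].
    by near: d.
  by rewrite /ratio (cover_efron_ratio (phi_even d) (phi_hyperplane d) (X_iid d)).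
have reduce (l : R) : binom_tail R (p1 d) (q1 d) @[d --> \oo] --> l ->
    ratio d @[d --> \oo] --> l.
  move=> h; apply: cvg_trans (near_eq_cvg ratioE) _.
  by rewrite -[l]mulr1 -invr1; apply: cvgM => //; apply: cvgV => //.
(* The gap is, up to 1, the amount by which the number of tosses exceeds twice the threshold; its
   size against [sqrt d] decides between the cases. *)
have gapE : \forall d \near \oo, 2 * (q1 d)%:R - (p1 d)%:R = 1 - gap d :> R.
  near=> d; have -> : (p1 d)%:R = (N d)%:R - (k d)%:R - 1 :> R by near: d.
  have -> : (q1 d)%:R = d%:R - (k d)%:R :> R by near: d.
  by rewrite /gap; lra.
have part_a (c : R) : gap d / Num.sqrt (d%:R : R) @[d --> \oo] --> c ->
    ratio d @[d --> \oo] --> std_normal_cdf (- (c / Num.sqrt (2 * (1 - rho)))).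
  move=> hc; apply: reduce; apply: binom_tail_cvg.
    apply/cvgryPge => A; near=> d.
    have d0 : (0 : R) < d%:R by rewrite ltr0n; near: d; exists 1%N.
    have h : 1 - rho <= (p1 d)%:R / d%:R by near: d; apply: (cvgr_ge _ p1_lim); lra.
    have hA : A / (1 - rho) <= d%:R by near: d; exact: nbhs_infty_ger.
    rewrite ler_pdivlMr// in h; rewrite ler_pdivrMr// mulrC in hA.
    exact: le_trans h.
  have sq_lim : Num.sqrt ((p1 d)%:R / d%:R : R) @[d --> \oo] -->
      Num.sqrt (2 * (1 - rho)).
    exact: (continuous_cvg _ (@sqrt_continuous R _) p1_lim).
  have isq_lim : (Num.sqrt (d%:R : R))^-1 @[d --> \oo] --> (0 : R).
    rewrite (_ : (fun d => _) = (fun d => Num.sqrt (d%:R^-1 : R))).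
      rewrite -[X in _ --> X]sqrtr0.
      exact: (continuous_cvg _ (@sqrt_continuous R _) inv_lim).
    by apply/funext => d; rewrite sqrtrV.
  (* The standardized point is [(1 - gap d) / sqrt (p1 d)]; numerator and denominator are divided by
     [sqrt d] before the limit is taken. *)
  have h : ((Num.sqrt (d%:R : R))^-1 - gap d / Num.sqrt (d%:R : R)) /
      Num.sqrt ((p1 d)%:R / d%:R : R) @[d --> \oo] -->
      (0 - c) / Num.sqrt (2 * (1 - rho)).
    apply: cvgM; first exact: cvgB.
    by apply: cvgV => //; rewrite gt_eqF// sqrtr_gt0 mulr_gt0.
  rewrite sub0r mulNr in h; apply: cvg_trans h; apply: near_eq_cvg; near=> d.
  have s0 : Num.sqrt (d%:R : R) != 0.
    by rewrite gt_eqF// sqrtr_gt0 ltr0n; near: d; exists 1%N.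
  rewrite /std_point (near gapE d)// sqrtrM// sqrtrV//.
  by rewrite invf_div mulrA -{1}[(Num.sqrt _)^-1]mul1r -mulrBl divfK.
split.
- move=> c hc p; split; first exact: part_a.
  exact: std_normal_cdf_gt0_lt1.
- move=> c alpha a1 a2 c0 hgap; apply: reduce.
  apply: (@binom_tail_cvg0 R p1 q1 3 (c / 2) alpha) => //; first by rewrite divr_gt0.
  have c2 : 0 < c / 2 by rewrite divr_gt0.
  near=> d; have g1 : 2 * (q1 d)%:R - (p1 d)%:R = 1 - gap d by near: d.
  have g2 : c * d%:R `^ alpha <= gap d by near: d.
  have g3 : (c / 2)^-1 <= d%:R `^ alpha.
    by near: d; move: (@powR_natr_cvgy R alpha ltac:(lra)) => /cvgryPge; exact.
  rewrite -div1r ler_pdivrMr// in g3.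
  by lra.
- move=> c alpha a0 a1 c0 hgap.
  (* With [alpha < 1 / 2] the gap is negligible against [sqrt d], so this is the case [c = 0] of the
     central limit regime. *)
  have h0 : gap d / Num.sqrt (d%:R : R) @[d --> \oo] --> (0 : R).
    have pw : c / (d%:R : R) `^ (1 / 2 - alpha) @[d --> \oo] --> (0 : R).
      rewrite -[X in _ --> X](mulr0 c); apply: cvgM; first exact: cvg_cst.
      apply/gtr0_cvgV0; last by apply: powR_natr_cvgy; lra.
      by near=> d; rewrite powR_gt0// ltr0n; near: d; exists 1%N.
    have npw : - (c / (d%:R : R) `^ (1 / 2 - alpha)) @[d --> \oo] --> (0 : R).
      by rewrite -[X in _ --> X]oppr0; exact: cvgN.
    apply: squeeze_cvgr; [|exact: npw|exact: pw]; near=> d.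
    have d0 : (0 : R) < d%:R by rewrite ltr0n; near: d; exists 1%N.
    have s0 : 0 < Num.sqrt (d%:R : R) by rewrite sqrtr_gt0.
    have -> : c / d%:R `^ (1 / 2 - alpha) = c * d%:R `^ alpha / Num.sqrt d%:R.
      rewrite powRB; last by rewrite (gt_eqF d0) implybT.
      by rewrite div1r powR12_sqrt ?ler0n// invf_div mulrA.
    rewrite ler_pdivlMr// ler_pdivrMr// mulNr !divfK ?gt_eqF// -mulNr.
    by near: d.
  have := part_a 0 h0; rewrite mul0r oppr0 std_normal_cdf0.
  by rewrite div1r.
- move=> c alpha a1 a2 c0 hgap; apply: reduce.
  (* Here the 1 in [gapE] has the favourable sign, and [- c] is kept in full. *)
  apply: (@binom_tail_cvg1 R p1 q1 3 (- c) alpha) => //; first by rewrite oppr_gt0.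
  near=> d; have g1 : 2 * (q1 d)%:R - (p1 d)%:R = 1 - gap d by near: d.
  have g2 : gap d <= c * d%:R `^ alpha by near: d.
  by lra.
Unshelve. all: by end_near.
Qed.
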